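(* There are no $3$-reflective bodies in $\mathbb{R}^2$ with piecewise-analytic boundary.
   Context: A body $B\subset\mathbb{R}^2$ is a (possibly disconnected) closed bounded perfectly reflecting set. For an oriented line $R$, take its first intersection point $A_1$ with the boundary $\partial B$ and reflect $R$ from the tangent line $T_{A_1}\partial B$ by the usual reflection law (angle of incidence equals angle of reflection). The reflected ray issues from $A_1$ and defines a new oriented line; the procedure is then repeated (first next intersection point of the reflected ray with $\partial B$, reflection there, and so on). If after a finite number $k$ of reflections the output oriented line coincides with the input oriented line $R$ and does not hit the body any more, then $B$ is said to be invisible in the direction $R$, and $R$ is called an invisibility direction with $k$ reflections. A body $B$ with piecewise-smooth boundary is called $k$-reflective if the set of its invisibility directions with $k$ reflections has positive measure (in the two-dimensional space of oriented lines in $\mathbb{R}^2$ with its natural measure). *)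

(* Defs.v *)
From mathcomp Require Import all_boot all_order all_algebra.
From mathcomp Require Import all_classical all_reals all_analysis.

Set Implicit Arguments.
Unset Strict Implicit.
Unset Printing Implicit Defensive.

Import Order.TTheory GRing.Theory Num.Theory.
Import numFieldNormedType.Exports.

Local Open Scope classical_set_scope.
Local Open Scope ring_scope.

(* The plane is [R * R].  Its library norm is the sup norm, which is used only
   for the topology and for boundedness; the Euclidean geometry enters through
   [dot]. *)
Definition dot (R : realType) (v w : R * R) : R := v.1 * w.1 + v.2 * w.2.

Definition boundary (R : realType) (B : set (R * R)) : set (R * R) :=
  closure B `\` interior B.

Definition body (R : realType) (B : set (R * R)) : Prop :=
  closed B /\ bounded_set B.

Definition analytic_at (R : realType) (f : R -> R) (x : R) : Prop :=
  exists (a : nat -> R) (r : R), 0 < r /\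
    forall h : R, `|h| < r -> pseries a h @ \oo --> f (x + h).

(* Analyticity and regularity are required only in the relative interior of
   the arc, so that cusps and similar singularities are allowed at its ends. *)
Definition analytic_arc (R : realType) (E : set (R * R)) : Prop :=
  exists (a b : R) (g : R -> R * R),
    [/\ a < b,
        {within `[a, b], continuous g},
        {in `[a, b] &, injective g},
        forall t, t \in `]a, b[ ->
          [/\ analytic_at (fst \o g) t, analytic_at (snd \o g) t
            & derive1 g t != 0]
      & E = g @` `[a, b]].

Definition piecewise_analytic (R : realType) (S : set (R * R)) : Prop :=
  exists (n : nat) (E : 'I_n -> set (R * R)),
    (forall i, analytic_arc (E i)) /\ S = \bigcup_i E i.

(* [v] spans the tangent line of [S] at [A]: the germ of [S] at [A] is the germ
   of a regular C^1 curve with velocity [v] at [A].  The last clause says that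
   arbitrarily short pieces of the curve already fill a neighbourhood of [A] in
   [S]; it excludes further branches of [S] through [A] (in particular [S] has
   no tangent line at a corner or at a crossing), and makes the tangent line
   unique. *)
Definition tangent_vector (R : realType) (S : set (R * R)) (A v : R * R) :
    Prop :=
  v != 0 /\
  exists g : R -> R * R,
    [/\ g 0 = A, derive1 g 0 = v,
        \forall t \near (0 : R), derivable g t 1 /\ {for t, continuous (derive1 g)},
        \forall t \near (0 : R), S (g t)
      & forall d : R, 0 < d ->
          \forall P \near A, S P -> exists2 t, `|t| < d & g t = P].

(* Reflection of the direction [v] in the line spanned by [t]. *)
Definition reflect_dir (R : realType) (t v : R * R) : R * R :=
  (2 * dot v t / dot t t) *: t - v.

(* An oriented line is encoded by [l = (theta, p)] with [0 <= theta < 2 pi]: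
   theta is the angle of its direction and p its signed distance to the
   origin. *)
Definition oriented_lines (R : realType) : set (R * R) :=
  [set l | 0 <= l.1 < 2 * pi].

Definition line_dir (R : realType) (l : R * R) : R * R := (cos l.1, sin l.1).

Definition line_point (R : realType) (l : R * R) (s : R) : R * R :=
  l.2 *: (- sin l.1, cos l.1) + s *: line_dir l.

Definition first_point_on_line (R : realType) (S : set (R * R))
    (l A : R * R) : Prop :=
  exists s : R, [/\ A = line_point l s, S A
                  & forall r, r < s -> ~ S (line_point l r)].

Definition first_point_on_ray (R : realType) (S : set (R * R))
    (A v A' : R * R) : Prop :=
  exists2 s : R, 0 < s &
    [/\ A' = A + s *: v, S A' & forall r, 0 < r < s -> ~ S (A + r *: v)].

(* [A i], for [1 <= i <= k], are the reflection points; [v 0] is the direction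
   of the input line and [v i] the direction after the i-th reflection. *)
Definition invisibility_direction (R : realType) (B : set (R * R)) (k : nat)
    (l : R * R) : Prop :=
  (0 < k)%N /\
  exists (A v : nat -> R * R),
    [/\ v 0%N = line_dir l /\ first_point_on_line (boundary B) l (A 1%N),
        forall i, (1 <= i <= k)%N ->
          exists2 t, tangent_vector (boundary B) (A i) t
                   & v i = reflect_dir t (v i.-1),
        forall i, (1 <= i < k)%N ->
          first_point_on_ray (boundary B) (A i) (v i) (A i.+1),
        v k = line_dir l /\ exists s, A k = line_point l s
      & forall s, 0 < s -> ~ B (A k + s *: v k)].

(* The natural measure on oriented lines is d(theta) dp. *)
Definition line_measure (R : realType) :
    set (measurableTypeR R * measurableTypeR R) -> \bar R :=
  ((@lebesgue_measure R) \x (@lebesgue_measure R))%E.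

(* Positive measure is expressed as "not contained in a measurable null set",
   i.e. positive outer measure; for Lebesgue measurable sets this is the usual
   meaning, and no measurability has to be presupposed. *)
Definition k_reflective (R : realType) (k : nat) (B : set (R * R)) : Prop :=
  ~ (@line_measure R).-negligible
      ((@oriented_lines R `&` [set l | invisibility_direction B k l])
        : set (measurableTypeR R * measurableTypeR R)).

(* Main.v *)
Require Import Defs.
From mathcomp Require Import all_boot all_order all_algebra.
From mathcomp Require Import all_classical all_reals all_analysis.
From mathcomp Require Import ring lra.

(** A line whose direction is one of invisibility with three reflections carries
    a triangle [A1 A2 A3] with vertices on the boundary: [A1] and [A3] lie on the
    line, the tangents at [A1] and [A3] are the internal bisectors of the triangle
    there, and the tangent at [A2] is the external one. Choose the three arcs that
    carry the vertices and parametrize them by [t1], [t2], [t3]; the claim is that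
    the triangles of this kind give only a null set of lines.

    The argument is an infinitesimal one. If a set [Z] of parameters is such that,
    at each of its points, some functions that vanish on [Z] have differentials
    whose common kernel is at most a line, then [Z] is locally a Lipschitz curve
    and so is its image in the plane of lines; this image is null
    ([negligible_tangent]). The functions must be differentiable in a strict sense,
    since two nearby points of [Z] are compared with one another.

    The triangles satisfy the reflection laws at [A1] and at [A2]. The differentials
    of these two equations are independent unless the curvatures of the arcs at [A1]
    and at [A2] have prescribed values in terms of the triangle ([rigid_fixing1],
    [rigid_fixing2]). So, up to a null set of lines, both curvatures are prescribed.
    The prescription at [A2] then is one more equation that vanishes on the
    remaining triangles ([mirror_eqn]), and it can be differentiated in turn. Let
    [A2] be fixed. Geometrically, the prescribed curvature at [A2] equals
    [sin a ^ 2 / h], where [a] is the angle between the sides and the tangent at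
    [A2] and [h] is the distance from [A2] to the incenter. The length
    [2 * h * sin a = |A1 A2| + |A2 A3| - |A1 A3|] is stationary by the reflection
    laws at [A1] and [A3], hence [sin a ^ 3], and with it the angle at [A2], would
    be stationary; but [A1] moves transversally to [A1 A2], so it stands still
    ([dmirror_neq0], [rigid_curvature]). Hence the last set of triangles is locally
    a curve as well, and all three pieces give null sets.

    It remains to discard the lines through end points of arcs, the lines tangent
    to an arc at [A1], and the lines reflected at [A1] towards an end point of an
    arc; each of these families depends on one parameter only. Analyticity of the
    arcs is used through the existence of three derivatives. *)

Set Implicit Arguments.
Unset Strict Implicit.
Unset Printing Implicit Defensive.
Import Order.TTheory GRing.Theory Num.Theory.
Import numFieldNormedType.Exports.
Local Open Scope classical_set_scope.
Local Open Scope ring_scope.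

(** * Vectors and reflections in the plane *)

Section plane.
Variable R : realType.
Implicit Types (P Q T a b c d v w : R * R) (t : R).

Definition cross v w : R := v.1 * w.2 - v.2 * w.1.

(** In complex notation this is the imaginary part of [conj (P * Q) * T ^ 2]: it
    vanishes when [T] is parallel to one of the two bisectors of [P] and [Q], and
    it is a polynomial, whereas the bisectors themselves involve lengths. *)
Definition bisects P Q T : R := cross P T * dot Q T + dot P T * cross Q T.

Lemma crossDl (a b c : R * R) : cross (a + b) c = cross a c + cross b c.
Proof. by case: a b c => [? ?] [? ?] [? ?]; rewrite /cross /=; ring. Qed.

Lemma crossZl (k : R) (a c : R * R) : cross (k *: a) c = k * cross a c.
Proof. by case: a c => [? ?] [? ?]; rewrite /cross /= /GRing.scale /=; ring. Qed.

Lemma crossvv (a : R * R) : cross a a = 0.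
Proof. by rewrite /cross mulrC subrr. Qed.

Lemma cross_le (a b : R * R) : `|cross a b| <= 2 * `|a| * `|b|.
Proof.
have le1 (c : R * R) : `|c.1| <= `|c| by rewrite [leRHS]prod_normE le_max lexx.
have le2 (c : R * R) : `|c.2| <= `|c| by rewrite [leRHS]prod_normE le_max lexx orbT.
rewrite /cross; apply: le_trans (ler_normB _ _) _.
rewrite -mulrA mulr_natl mulr2n !normrM.
by apply: lerD; apply: ler_pM.
Qed.

Lemma dot_self_neq0 P : P != 0 -> dot P P != 0.
Proof.
case: P => x y; apply: contra; rewrite /dot /= paddr_eq0 ?sqr_ge0 // -!expr2.
by rewrite !sqrf_eq0 => /andP[/eqP -> /eqP ->].
Qed.

Lemma dot_neq0_parallel P T : cross P T = 0 -> dot P P != 0 -> T != 0 -> dot P T != 0.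
Proof.
move=> c0 P0; apply: contra => /eqP d0.
have T0 x : dot P P * x = 0 -> x = 0.
  by move/eqP; rewrite mulf_eq0 (negPf P0) => /eqP.
apply/eqP; case: T c0 d0 => [x y] c0 d0; congr pair; apply: T0.
  rewrite (_ : _ * x = P.1 * dot P (x, y) - P.2 * cross P (x, y)); last first.
    by case: (P) => ? ?; rewrite /dot /cross /=; ring.
  by rewrite c0 d0 !mulr0 subrr.
rewrite (_ : _ * y = P.2 * dot P (x, y) + P.1 * cross P (x, y)); last first.
  by case: (P) => ? ?; rewrite /dot /cross /=; ring.
by rewrite c0 d0 !mulr0 addr0.
Qed.

Lemma parallelE T w : T != 0 -> cross T w = 0 -> w = (dot T w / dot T T) *: T.
Proof.
move=> /dot_self_neq0; case: T w => [a b] [x y].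
rewrite /cross /dot /= => n0 c0.
have ay : a * y = b * x by apply/eqP; rewrite -subr_eq0 c0.
congr pair; rewrite /= /GRing.scale /=; apply: (mulIf n0); rewrite mulrAC divfK //;
  ring: ay.
Qed.

Definition dbisects P Q T P' Q' T' : R :=
  (cross P' T + cross P T') * dot Q T + cross P T * (dot Q' T + dot Q T') +
  ((dot P' T + dot P T') * cross Q T + dot P T * (cross Q' T + cross Q T')).

(** In complex notation [T ^ 2 = dot T T * v * w], because [T] is parallel to the
    sum of the unit vectors [v] and [w]. This turns the terms where [P] or [Q]
    vary into single cross products, and the one where [T] varies into
    [cross T T'], which is the curvature of the mirror up to a power of its speed
    when [T'] is the acceleration. *)
Lemma dbisects_linear P Q T v w X Y T' (m s c : R) :
  dot v v = 1 -> dot w w = 1 -> T = m *: (v + w) ->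
  P = s *: v -> Q = c *: w ->
  dbisects P Q T X Y T' =
  dot T T * (c * cross X v + s * cross Y w) + 2 * s * c * cross T T'.
Proof.
move=> vv ww -> -> ->; move: vv ww; rewrite /dbisects /dot /cross /=.
case: v w X Y T' => [v1 v2] [w1 w2] [x1 x2] [y1 y2] [t1 t2] /= vv ww.
have {}vv : v1 ^+ 2 = 1 - v2 ^+ 2 by rewrite -vv; ring.
have {}ww : w1 ^+ 2 = 1 - w2 ^+ 2 by rewrite -ww; ring.
by rewrite /= /GRing.scale /=; ring: vv ww.
Qed.

(** The case of a fixed vertex, where only the direction [Q] turns. *)
Lemma dbisects_turn P Q T X Y T' (k : R) :
  dbisects P Q T (0 - 0 *: X) (k *: Y) (0 *: T') = k * bisects P Y T.
Proof.
case: P Q T X Y T' => [? ?] [? ?] [? ?] [? ?] [? ?] [? ?].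
by rewrite /dbisects /bisects /cross /dot /= /GRing.scale /=; ring.
Qed.

Definition dir (t : R) : R * R := (cos t, sin t).
Definition dir' (t : R) : R * R := (- sin t, cos t).

Lemma dir_unit (t : R) : dot (dir t) (dir t) = 1.
Proof. by rewrite /dot /= -!expr2 cos2Dsin2. Qed.

Lemma cross_dir' (t : R) : cross (dir t) (dir' t) = 1.
Proof. by rewrite /cross /= mulrN opprK -!expr2 cos2Dsin2. Qed.

Lemma reflect_dir_parallel T w v : T != 0 -> w != 0 -> cross T w = 0 ->
  reflect_dir w v = reflect_dir T v.
Proof.
move=> T0 w0 Tw; have TT := dot_self_neq0 T0.
have dTw := dot_neq0_parallel Tw TT w0.
rewrite (parallelE T0 Tw); set q := dot T w / dot T T.
have q0 : q != 0 by rewrite mulf_neq0 // invr_eq0.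
rewrite /reflect_dir; congr (_ - _); rewrite scalerA; congr (_ *: _).
have -> : dot v (q *: T) = q * dot v T.
  by case: (v) (T) => [? ?] [? ?]; rewrite /dot /= /GRing.scale /=; ring.
have -> : dot (q *: T) (q *: T) = q ^+ 2 * dot T T.
  by case: (T) => [? ?]; rewrite /dot /= /GRing.scale /=; ring.
by field; rewrite q0 TT.
Qed.

Lemma dot_reflect_dir T v : T != 0 ->
  dot (reflect_dir T v) (reflect_dir T v) = dot v v.
Proof.
move=> /dot_self_neq0; case: T v => [a b] [x y].
by rewrite /reflect_dir /dot /= /GRing.scale /= => n0; field.
Qed.

Lemma reflect_dirN T v : reflect_dir T (- v) = - reflect_dir T v.
Proof.
by case: T v => [a b] [x y]; congr pair;
  rewrite /reflect_dir /dot /= /GRing.scale /=; ring.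
Qed.

Lemma reflect_dirK T v : T != 0 -> reflect_dir T (reflect_dir T v) = v.
Proof.
move=> /dot_self_neq0; case: T v => [a b] [x y].
rewrite /reflect_dir /dot /= /GRing.scale /= => n0.
by congr pair; rewrite /= /GRing.scale /=; field.
Qed.

Lemma bisects_reflect_dir T v (s : R) : T != 0 ->
  bisects (s *: reflect_dir T v) v T = 0.
Proof.
move=> /dot_self_neq0; case: T v => [a b] [x y].
by rewrite /bisects /cross /reflect_dir /dot /= /GRing.scale /= => n0; field.
Qed.

Lemma cross_reflect_dir T v :
  cross (reflect_dir T v) v = 2 * dot v T / dot T T * cross T v.
Proof.
case: T v => [a b] [x y].
by rewrite /cross /reflect_dir /dot /= /GRing.scale /=; ring.
Qed.

(** A mirror is parallel to the sum of the incoming and the outgoing direction;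
    [cross v w != 0] excludes that this sum is zero. *)
Lemma mirror_bisector T v w : T != 0 -> w = reflect_dir T v -> cross v w != 0 ->
  exists2 m, m != 0 & T = m *: (v + w).
Proof.
move=> T0 -> vw; exists (2 * dot v T / dot T T)^-1.
  rewrite invr_eq0; apply: contra_neq vw => e0.
  have -> : cross v (reflect_dir T v) = - cross (reflect_dir T v) v by rewrite /cross; ring.
  by rewrite cross_reflect_dir e0 mul0r oppr0.
have e0 : 2 * dot v T / dot T T != 0.
  apply: contra_neq vw => e0.
  have -> : cross v (reflect_dir T v) = - cross (reflect_dir T v) v by rewrite /cross; ring.
  by rewrite cross_reflect_dir e0 mul0r oppr0.
by rewrite /reflect_dir addrC subrK scalerA mulVf // scale1r.
Qed.
End plane.

(** * Null sets of lines *)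

Section negligible_sets.
Variable R : realType.
Let lines : Type := (measurableTypeR R * measurableTypeR R)%type.
Local Notation mu := (@line_measure R).

Lemma negligible_bigcup_countable (I : countType) (F : I -> set lines) :
  (forall i, mu.-negligible (F i)) -> mu.-negligible (\bigcup_i F i).
Proof.
move=> F0; apply: (@negligibleS _ _ _ _
    (\bigcup_n (if unpickle n is Some i then F i else set0))).
  by move=> l [i _ Fl]; exists (pickle i) => //; rewrite pickleK.
apply: negligible_bigcup => n; case: unpickle => [i|]; first exact: F0.
exact: negligible_set0.
Qed.

Lemma invS_lt (e : R) : 0 < e -> exists n, n.+1%:R^-1 < e.
Proof.
move=> e0; exists (Num.trunc e^-1); rewrite invf_plt ?posrE //.
by have /truncn_itv/andP[] : 0 <= e^-1 by rewrite invr_ge0 ltW.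
Qed.

(** A null set that contains [N] is the intersection of the given covers. *)
Lemma negligible_le_eps (N : set lines) :
  (forall n, exists A, [/\ measurable A, N `<=` A & (mu A <= (n.+1%:R^-1)%:E)%E]) ->
  mu.-negligible N.
Proof.
move=> /choice[A HA]; exists (\bigcap_n A n); split.
- by apply: bigcapT_measurable => n; case: (HA n).
- apply/eqP; rewrite eq_le measure_ge0 andbT.
  apply/lee_addgt0Pr => e e0; rewrite add0e.
  have [n ne] := invS_lt e0.
  have [mA _ Ale] := HA n.
  apply: le_trans (_ : mu (A n) <= _)%E; last first.
    by apply: le_trans Ale _; rewrite lee_fin ltW.
  apply: le_measure; rewrite ?inE //; last by move=> l; apply.
  by apply: bigcapT_measurable => m; case: (HA m).
- by move=> l Nl n _; case: (HA n) => _ + _; apply.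
Qed.

Lemma line_measure_square (x y h : R) : 0 <= h ->
  mu ((closed_ball x h : set (measurableTypeR R)) `*`
      (closed_ball y h : set (measurableTypeR R))) = ((2 * h) ^+ 2)%:E.
Proof.
move=> h0; apply: etrans (_ : (h *+ 2)%:E * (h *+ 2)%:E = _)%E.
  rewrite -{1}(@lebesgue_measure_closed_ball R x h h0).
  rewrite -(@lebesgue_measure_closed_ball R y h h0).
  by apply: product_measure1E; exact: measurable_realfun.measurable_closed_ball.
by rewrite -EFinM -[h *+ 2]mulr_natl expr2.
Qed.

(** Cut the interval where [s] takes its values into cells of length [1 / (n + 1)]:
    the points with [s] in a given cell are mapped into a square of side
    [2 * C / (n + 1)], and there are [O(n)] cells, so the total area is
    [O(1 / n)]. *)
Lemma negligible_lipschitz_image (I : Type) (Z : set I) (s p q : I -> R)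
    (K C : R) :
  (forall z, Z z -> `|s z| <= K) ->
  (forall z z', Z z -> Z z' -> `|p z - p z'| <= C * `|s z - s z'|) ->
  (forall z z', Z z -> Z z' -> `|q z - q z'| <= C * `|s z - s z'|) ->
  mu.-negligible ((fun z => (p z, q z) : lines) @` Z).
Proof.
wlog : K C / 0 < K /\ 0 < C => [hwlog sK pC qC|[K0 C0] sK pC qC].
  apply: (hwlog (Num.max K 1) (Num.max C 1)).
  - by rewrite !lt_max ltr01 !orbT.
  - by move=> z /sK; rewrite le_max => ->.
  - move=> z z' Zz Zz'; apply: le_trans (pC _ _ Zz Zz') _.
    by rewrite ler_wpM2r // le_max lexx.
  - move=> z z' Zz Zz'; apply: le_trans (qC _ _ Zz Zz') _.
    by rewrite ler_wpM2r // le_max lexx.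
apply: negligible_le_eps => m.
have [n nE] : exists n, m.+1%:R * (2 * K + 1) * (2 * C) ^+ 2 < n.+1%:R :> R.
  exists (Num.trunc (m.+1%:R * (2 * K + 1) * (2 * C) ^+ 2)).
  suff /truncn_itv/andP[] : 0 <= m.+1%:R * (2 * K + 1) * (2 * C) ^+ 2 by [].
  by rewrite mulr_ge0 ?sqr_ge0 // mulr_ge0 // addr_ge0 // mulr_ge0 // ltW.
have n0 : 0 < n.+1%:R :> R by [].
(* [s z + K] is nonnegative, so that truncation to a natural number gives the
   index of the cell. *)
pose cell (k : nat) : set I :=
  [set z | Z z /\ k%:R <= (s z + K) * n.+1%:R < k.+1%:R].
pose M := (Num.trunc (2 * K * n.+1%:R : R)).+1.
(* The square is centred at the image of a point of the cell, if there is one. *)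
pose sq (k : nat) : set lines := if pselect (exists z, cell k z) is left e
  then let z := sval (cid e) in
    (closed_ball (p z) (C / n.+1%:R) : set (measurableTypeR R)) `*`
    (closed_ball (q z) (C / n.+1%:R) : set (measurableTypeR R))
  else set0.
have Cn0 : 0 < C / n.+1%:R by rewrite divr_gt0.
have msq k : measurable (sq k).
  rewrite /sq; case: pselect => // e.
  by apply: measurableX; exact: measurable_realfun.measurable_closed_ball.
have mA : measurable (\big[setU/set0]_(k < M) sq k).
  by apply: bigsetU_measurable => k _; exact: msq.
exists (\big[setU/set0]_(k < M) sq k); split => //.
- move=> _ [z Zz <-]; rewrite -bigcup_mkord.
  have /andP[sz1 sz2] : 0 <= s z + K <= 2 * K.
    by move: (sK _ Zz); rewrite ler_norml => /andP[? ?]; apply/andP; lra.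
  have t0 : 0 <= (s z + K) * n.+1%:R by rewrite mulr_ge0.
  have cz : cell (Num.trunc ((s z + K) * n.+1%:R)) z.
    by split => //; exact: truncn_itv.
  exists (Num.trunc ((s z + K) * n.+1%:R)).
    by rewrite /M /= ltnS le_truncn // ler_wpM2r.
  rewrite /sq; case: pselect => [e|[]]; last by exists z.
  case: cid => z' /= [Zz' /andP[z'1 z'2]]; case: cz => _ /andP[z1 z2].
  have d : `|s z' - s z| <= n.+1%:R^-1.
    rewrite -[leRHS]mul1r ler_pdivlMr // -[n.+1%:R]gtr0_norm // -normrM.
    by rewrite ler_norml; move: z1 z2 z'1 z'2; rewrite -!natr1 => *; apply/andP; lra.
  rewrite !closed_ballE // /closed_ball_ /=.
  have dC r : r <= C * `|s z' - s z| -> r <= C / n.+1%:R.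
    by move=> /le_trans; apply; rewrite ler_wpM2l // ltW.
  by split => /=; apply: dC; [exact: pC|exact: qC].
- apply: le_trans (@content_subadditive _ _ _ mu _ sq M _ mA (subset_refl _)) _ => //.
  apply: (@le_trans _ _ (\sum_(k < M) ((2 * (C / n.+1%:R)) ^+ 2)%:E)%E).
    apply: lee_sum => k _; rewrite /sq; case: pselect => [e|_].
      rewrite le_eqVlt; apply/orP; left; apply/eqP.
      exact: (line_measure_square _ _ (ltW Cn0)).
    by rewrite measure0 lee_fin sqr_ge0.
  rewrite sumEFin lee_fin sumr_const card_ord -[leLHS]mulr_natl.
  have M1 : M%:R <= (2 * K + 1) * n.+1%:R :> R.
    rewrite /M -natr1 [leRHS]mulrDl mul1r; apply: lerD.
      suff /truncn_itv/andP[] : 0 <= 2 * K * n.+1%:R by [].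
      by rewrite mulr_ge0 // mulr_ge0 // ltW.
    by rewrite ler1n.
  apply: (@le_trans _ _ ((2 * K + 1) * n.+1%:R * (2 * (C / n.+1%:R)) ^+ 2)).
    by rewrite ler_wpM2r // sqr_ge0.
  rewrite -[leRHS]mul1r ler_pdivlMr //.
  set x := n.+1%:R; have x0 : x != 0 by rewrite gt_eqF.
  rewrite (_ : _ * m.+1%:R = m.+1%:R * (2 * K + 1) * (2 * C) ^+ 2 / x).
    by rewrite ler_pdivrMr // mul1r ltW.
  by field.
Qed.
End negligible_sets.

(** * Analytic functions and curves *)

Section analytic.
Variable R : realType.
Implicit Types (c : nat -> R) (f : R -> R).

(** Each of the [n + 1] terms of [\sum_(i < n.+1) t ^+ i] is at least [t ^+ n]. *)
Lemma le_sumX (t : R) n : 0 <= t <= 1 -> n.+1%:R * t ^+ n * (1 - t) <= 1.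
Proof.
move=> /andP[t0 t1]; apply: (@le_trans _ _ ((\sum_(i < n.+1) t ^+ i) * (1 - t))).
  rewrite ler_wpM2r ?subr_ge0 // mulr_natl -[X in _ *+ X]card_ord -sumr_const.
  by apply: ler_sum => i _; apply: ler_wiXn2l => //; rewrite -ltnS.
rewrite mulrC -opprB mulNr -subrX1 opprB gerBl.
exact: exprn_ge0.
Qed.

(** The factor [n + 1] is absorbed by passing from [z] to an intermediate radius
    [rho]; what is left is dominated by a geometric series of ratio
    [rho / `|x|]. *)
Lemma cvg_pseries_diffs c (x z : R) : cvgn (pseries c x) -> `|z| < `|x| ->
  cvgn (pseries (pseries_diffs c) z).
Proof.
move=> cx zx; have [M [Mreal Mc]] := cvg_series_bounded cx.
have [rho zr rx] : exists2 rho, `|z| < rho & rho < `|x|.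
  by exists ((`|z| + `|x|) / 2); lra.
have r0 : 0 < rho by exact: le_lt_trans zr.
have x0 : 0 < `|x| by exact: le_lt_trans zx.
pose t := `|z| / rho.
have t0 : 0 <= t by rewrite divr_ge0 // ltW.
have t1 : t < 1 by rewrite ltr_pdivrMr // mul1r.
pose q := rho / `|x|.
have q0 : 0 <= q by rewrite divr_ge0 // ltW.
have q1 : q < 1 by rewrite ltr_pdivrMr // mul1r.
pose B := (1 - t)^-1.
have B0 : 0 <= B by rewrite invr_ge0 subr_ge0 ltW.
have M0 : 0 <= `|M| + 1 by rewrite addr_ge0.
apply: normed_cvg; apply: (@series_le_cvg _ _
   (geometric (B * (`|M| + 1) / `|x|) q)) => [n|n|n|].
- exact: normr_ge0.
- by rewrite /= mulr_ge0 ?exprn_ge0 // divr_ge0 // mulr_ge0.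
- rewrite /= /pseries_diffs !normrM normrX ger0_norm //.
  have cM : `|c n.+1| * `|x| ^+ n.+1 <= `|M| + 1.
    rewrite -normrX -normrM; apply: (Mc (`|M| + 1)) => //.
    by rewrite (le_lt_trans (ler_norm M)) // ltrDl.
  have tB : n.+1%:R * t ^+ n <= B.
    rewrite -[leRHS]mul1r ler_pdivlMr ?subr_gt0 //.
    by apply: le_sumX; rewrite t0 ltW.
  have -> : n.+1%:R * `|c n.+1| * `|z| ^+ n =
      (n.+1%:R * t ^+ n) * (`|c n.+1| * `|x| ^+ n.+1) * (q ^+ n / `|x|).
    rewrite /t /q !expr_div_n exprS; field.
    by rewrite !expf_neq0 gt_eqF.
  rewrite (_ : _ / `|x| * _ = B * (`|M| + 1) * (q ^+ n / `|x|)); last by ring.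
  apply: ler_wpM2r; first by rewrite divr_ge0 ?exprn_ge0.
  by apply: ler_pM => //; rewrite mulr_ge0 ?exprn_ge0.
- by apply: is_cvg_geometric_series; rewrite ger0_norm.
Qed.

(** Termwise differentiation keeps the radius of convergence. *)
Lemma analytic_at_derive f x : analytic_at f x ->
  (\forall t \near x, derivable f t 1) /\ analytic_at (derive1 f) x.
Proof.
move=> [c [r [r0 fc]]].
have fE h : `|h| < r -> f (x + h) = limn (pseries c h).
  by move=> /fc/cvg_lim ->.
have key h : `|h| < r -> is_derive (x + h) 1 f (limn (pseries (pseries_diffs c) h)) /\
    cvgn (pseries (pseries_diffs c) h).
  move=> hr.
  (* Two termwise derivatives must converge beyond [h], and each of them costs
     some radius; hence three intermediate radii. *)
  pose k1 := (`|h| + r) / 2; pose k2 := (k1 + r) / 2; pose k3 := (k2 + r) / 2.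
  have h0 := normr_ge0 h.
  have [k10 k20 k30] : [/\ `|k1| = k1, `|k2| = k2 & `|k3| = k3].
    by split; apply: ger0_norm; rewrite /k3 /k2 /k1; lra.
  have hk1 : `|h| < `|k1| by rewrite k10 /k1; lra.
  have k12 : `|k1| < `|k2| by rewrite k10 k20 /k2 /k1; lra.
  have k23 : `|k2| < `|k3| by rewrite k20 k30 /k3 /k2 /k1; lra.
  have k3r : `|k3| < r by rewrite k30 /k3 /k2 /k1; lra.
  have c3 : cvgn (pseries c k3) by apply/cvg_ex; eexists; exact: fc.
  have d2 := cvg_pseries_diffs c3 k23.
  have dd1 := cvg_pseries_diffs d2 k12.
  have d1 := is_cvg_pseries_inside d2 k12.
  have c1 := is_cvg_pseries_inside c3 (lt_trans k12 k23).
  split; last exact: is_cvg_pseries_inside d1 hk1.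
  have Dp := pseries_snd_diffs c1 d1 dd1 hk1.
  have Dt : is_derive (x + h) 1 (fun t : R => t - x) (1 : R).
    by apply: is_derive_eq; rewrite subr0.
  have hE : (x + h) - x = h by rewrite addrC addKr.
  have Dc : is_derive (x + h) 1 ((fun y => limn (pseries c y)) \o (fun t : R => t - x))
      (limn (pseries (pseries_diffs c) h) * 1).
    by apply: is_derive1_comp; rewrite hE.
  rewrite mulr1 in Dc; apply: near_eq_is_derive Dc.
  near=> t => /=; rewrite -fE; first by rewrite addrC subrK.
  near: t; apply/nbhs_ballP; exists (r - `|h|); first by rewrite /= subr_gt0.
  move=> t; rewrite /ball /= => tx.
  rewrite (_ : t - x = h - (x + h - t)); last by ring.
  by apply: le_lt_trans (ler_normB _ _) _; lra.
split.
  apply/nbhs_ballP; exists r => // t; rewrite /ball /= distrC => tr.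
  by have [[]] := key (t - x) tr; rewrite addrC subrK.
exists (pseries_diffs c), r; split => // h hr.
have [[_ fd] cd] := key h hr.
by rewrite derive1E fd.
Unshelve. all: by end_near. Qed.

Lemma analytic_at_continuous f x : analytic_at f x -> {for x, continuous f}.
Proof.
move=> /analytic_at_derive[/nbhs_singleton fx _].
exact/differentiable_continuous/derivable1_diffP.
Qed.

Lemma analytic_at_C1 f x : analytic_at f x ->
  (\forall t \near x, derivable f t 1) /\ {for x, continuous (derive1 f)}.
Proof. by move=> /analytic_at_derive[? /analytic_at_continuous]. Qed.
End analytic.

Section curves.
Variable R : realType.
Implicit Types (S : set (R * R)) (g : R -> R * R) (t : R) (v : R * R).

Lemma derivable_approx (V : normedModType R) (f : R -> V) (x : R) :
  derivable f x 1 -> forall e, 0 < e -> exists2 d, 0 < d & forall h, `|h| < d ->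
    `|f (x + h) - f x - h *: derive1 f x| <= e * `|h|.
Proof.
move=> fx e e0.
have : h^-1 *: ((f \o shift x) (h *: 1) - f x) @[h --> 0^'] --> derive1 f x.
  by rewrite derive1E; exact: fx.
move=> /cvgrPdist_le/(_ e e0)/nbhs_ballP[/= d d0 fd]; exists d => // h hd.
have [->|h0] := eqVneq h 0.
  by rewrite addr0 scale0r !subrr !normr0 mulr0.
have := fd h; rewrite /ball /= sub0r normrN => /(_ hd h0).
rewrite [h *: 1]mulr1 [h + x]addrC -(@ler_pM2r _ `|h|) ?normr_gt0 //.
apply: le_trans; rewrite mulrC -normrZ scalerBr scalerA divff // scale1r.
by rewrite -normrN opprB.
Qed.

Lemma derive1_pair (g : R -> R * R) t :
  derivable (fst \o g) t 1 -> derivable (snd \o g) t 1 ->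
  derivable g t 1 /\ derive1 g t = (derive1 (fst \o g) t, derive1 (snd \o g) t).
Proof.
move=> g1 g2.
have H : h^-1 *: ((g \o shift t) (h *: 1) - g t) @[h --> 0^'] -->
    (derive1 (fst \o g) t, derive1 (snd \o g) t).
  rewrite (_ : (fun h => _) = (fun h =>
     (h^-1 *: (((fst \o g) \o shift t) (h *: 1) - (fst \o g) t),
      h^-1 *: (((snd \o g) \o shift t) (h *: 1) - (snd \o g) t)))) //.
  apply: (@cvg_pair _ _ _ _ (nbhs (derive1 (fst \o g) t))
    (nbhs (derive1 (snd \o g) t))).
    by rewrite derive1E; exact: g1.
  by rewrite derive1E; exact: g2.
have gd : derivable g t 1 by apply/cvg_ex; eexists; exact: H.
by split => //; rewrite derive1E; apply/cvg_lim.
Qed.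

Definition analytic_curve_at (g : R -> R * R) t :=
  analytic_at (fst \o g) t /\ analytic_at (snd \o g) t.

Lemma near_eq_analytic_at (f g : R -> R) t :
  (\forall s \near t, f s = g s) -> analytic_at f t -> analytic_at g t.
Proof.
move=> /nbhs_ballP[/= d d0 fg] [c [r [r0 fc]]].
exists c, (Num.min r d); rewrite lt_min r0 d0; split => // h.
rewrite lt_min => /andP[hr hd]; rewrite -fg; first exact: fc.
by rewrite /ball /= opprD addNKr normrN.
Qed.

Lemma analytic_curve_derive g t : analytic_curve_at g t ->
  derivable g t 1 /\ analytic_curve_at (derive1 g) t.
Proof.
move=> [/analytic_at_derive[d1 a1] /analytic_at_derive[d2 a2]].
split; first by have [] := derive1_pair (nbhs_singleton d1) (nbhs_singleton d2).
have dg : \forall s \near t,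
    derive1 g s = (derive1 (fst \o g) s, derive1 (snd \o g) s).
  by apply: filterS2 d1 d2 => s g1 g2; exact: (derive1_pair g1 g2).2.
by split; [apply: near_eq_analytic_at a1|apply: near_eq_analytic_at a2];
  apply: filterS dg => s /= ->.
Qed.

(** Both the arc [g] and the germ [h] that defines the tangent line run through
    the same points near [g t], since short pieces of [h] fill a neighbourhood in
    [S]. A small chord of [S] thus is nearly parallel to [derive1 g t] and to
    [v] at the same time. *)
Lemma tangent_vector_parallel S (g : R -> R * R) t v :
  derivable g t 1 -> (\forall s \near t, S (g s)) ->
  tangent_vector S (g t) v -> cross (derive1 g t) v = 0.
Proof.
move=> gd Sg [v0 [h [h0 hv hd Sh hfill]]].
set U := derive1 g t.
apply/eqP; apply: contraT => K0.
have {}K0 : 0 < `|cross U v| by rewrite normr_gt0.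
have m0 : 0 < `|v| by rewrite normr_gt0.
(* [L] is chosen such that the error terms below add up to at most
   [k * (e * L)]. *)
pose L := 4 * `|U| + 4 + 2 * `|v|.
have L0 : 0 < L by rewrite /L ltr_wpDr ?mulr_ge0 // ltr_wpDl ?mulr_ge0.
have [e [e0 e1 em eK]] : exists e, [/\ 0 < e, e <= 1, e <= `|v| / 2 & e * L < `|cross U v|].
  exists (Num.min 1 (Num.min (`|v| / 2) (`|cross U v| / 2 / L))).
  rewrite !lt_min !ge_min !lexx ltr01 !divr_gt0 //= !orbT; split => //.
  apply: (@le_lt_trans _ _ (`|cross U v| / 2 / L * L)).
    by rewrite ler_pM2r // !ge_min lexx !orbT.
  by rewrite divfK ?gt_eqF // ltr_pdivrMr // mulr_natr mulr2n ltrDl.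
have [dh dh0 happ] := derivable_approx (nbhs_singleton hd).1 e0.
have [dg dg0 gapp] := derivable_approx gd e0.
have gcont : {for t, continuous g}.
  exact/differentiable_continuous/derivable1_diffP.
have near_A : \forall s \near t, S (g s) -> exists2 r, `|r| < dh & h r = g s.
  exact: gcont _ (hfill dh dh0).
have /nbhs_ballP[/= d1 d10 Hd1] : \forall s \near t, exists2 r, `|r| < dh & h r = g s.
  by apply: filterS2 Sg near_A => s Ss; apply.
pose k := Num.min d1 dg / 2.
have mk : 0 < Num.min d1 dg by rewrite lt_min d10.
have k0 : 0 < k by rewrite divr_gt0.
have [kd1 kdg] : k < d1 /\ k < dg.
  apply/andP; rewrite -lt_min /k ltr_pdivrMr // mulr_natr mulr2n ltrDl //.
have [r rdh hr] : exists2 r, `|r| < dh & h r = g (t + k).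
  by apply: Hd1; rewrite /ball /= opprD addNKr normrN gtr0_norm.
have := gapp k; rewrite gtr0_norm // => /(_ kdg) gk.
have := happ r rdh; rewrite add0r h0 hr hv => hk.
set P := g (t + k) - g t in gk hk.
have PU : k *: U + (P - k *: U) = P by rewrite addrC subrK.
have Pv : r *: v + (P - r *: v) = P by rewrite addrC subrK.
have c1 : k * cross U v + cross (P - k *: U) v = cross (P - r *: v) v.
  transitivity (cross P v); first by rewrite -crossZl -crossDl PU.
  rewrite -{1}Pv (crossDl (r *: v)) (crossZl r v) crossvv mulr0 add0r //.
have b1 : `|cross (P - r *: v) v| <= 2 * (e * `|r|) * `|v|.
  by apply: le_trans (cross_le _ _) _; rewrite ler_wpM2r // ler_wpM2l.
have b2 : `|cross (P - k *: U) v| <= 2 * (e * k) * `|v|.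
  by apply: le_trans (cross_le _ _) _; rewrite ler_wpM2r // ler_wpM2l.
have b3 : k * `|cross U v| <= 2 * (e * `|r|) * `|v| + 2 * (e * k) * `|v|.
  rewrite -[X in X * _]gtr0_norm // -normrM.
  rewrite (_ : k * _ = cross (P - r *: v) v - cross (P - k *: U) v); last first.
    by rewrite -c1 addrK.
  by apply: le_trans (ler_normB _ _) _; rewrite lerD.
have b4 : `|r| * `|v| <= 2 * ((`|U| + 1) * k).
  have : `|r| * `|v| <= `|P| + e * `|r|.
    rewrite -normrZ -{1}(subKr P (r *: v)).
    by apply: le_trans (ler_normB _ _) _; rewrite lerD2l.
  have : `|P| <= k * `|U| + e * k.
    rewrite -[in leLHS]PU; apply: le_trans (ler_normD _ _) _.
    by rewrite normrZ gtr0_norm // lerD2l.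
  have : e * `|r| <= `|v| / 2 * `|r| by rewrite ler_wpM2r.
  have : e * k <= 1 * k by rewrite ler_wpM2r // ltW.
  lra.
have b5 : k * `|cross U v| <= k * (e * L).
  apply: le_trans b3 _.
  have : 2 * e * (`|r| * `|v|) <= 2 * e * (2 * ((`|U| + 1) * k)).
    by rewrite ler_wpM2l // mulr_ge0 // ltW.
  rewrite /L; lra.
by move: b5; rewrite ler_pM2l // leNgt eK.
Qed.

End curves.

(** * Strict differentiability *)

Section strict_derivative.
Variables (R : realType) (n : nat).
Local Notation V := 'rV[R]_n.
Implicit Types (f g h : V -> R) (x y z v : V) (a b : V -> R).

Definition linear_form a : Prop :=
  exists c : 'I_n -> R, forall v, a v = \sum_i c i * v 0 i.

(** Both points [x] and [y] move, unlike in the usual differential. This is what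
    bounds the distance of two zeros of several functions, and it is stable under
    sums and products at a single point, without any continuity of partial
    derivatives. *)
Definition strict_deriv f z a : Prop :=
  linear_form a /\
  forall e, 0 < e -> exists2 d, 0 < d & forall x y, `|x - z| < d ->
    `|y - z| < d -> `|f x - f y - a (x - y)| <= e * `|x - y|.

Lemma coord_le_norm v i : `|v 0 i| <= `|v|.
Proof.
have := @mx_normrE R 1 n v; rewrite /Num.norm /= => ->.
exact: (le_bigmax_cond _ (fun i => `|v i.1 i.2|) (j := (0, i))).
Qed.

Lemma linear_form_bound a : linear_form a ->
  exists2 C, 0 <= C & forall v, `|a v| <= C * `|v|.
Proof.
move=> [c aE]; exists (\sum_i `|c i|); first exact: sumr_ge0.
move=> v; rewrite aE; apply: le_trans (ler_norm_sum _ _ _) _.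
rewrite mulr_suml; apply: ler_sum => i _; rewrite normrM ler_wpM2l //.
exact: coord_le_norm.
Qed.

Lemma linear_formB a v w : linear_form a -> a (v - w) = a v - a w.
Proof.
move=> [c aE]; rewrite !aE -sumrB; apply: eq_bigr => i _.
by rewrite !mxE mulrBr.
Qed.

Lemma linear_formZ a k v : linear_form a -> a (k *: v) = k * a v.
Proof.
move=> [c aE]; rewrite !aE mulr_sumr; apply: eq_bigr => i _.
by rewrite !mxE mulrCA.
Qed.

Lemma strict_deriv_lipschitz f z a : strict_deriv f z a ->
  exists C d, [/\ 0 <= C, 0 < d & forall x y, `|x - z| < d -> `|y - z| < d ->
    `|f x - f y| <= C * `|x - y|].
Proof.
move=> [la /(_ 1 ltr01)[d d0 fd]]; have [C C0 aC] := linear_form_bound la.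
exists (1 + C), d; split => // [|x y xd yd]; first by rewrite addr_ge0.
rewrite -(subrK (a (x - y)) (f x - f y)) mulrDl.
by apply: le_trans (ler_normD _ _) _; apply: lerD; [exact: fd|exact: aC].
Qed.

Lemma strict_deriv_eq f z a b : a =1 b -> strict_deriv f z a ->
  strict_deriv f z b.
Proof. by move=> /funext->. Qed.

Lemma strict_deriv_cst (k : R) z : strict_deriv (fun=> k) z (fun=> 0).
Proof.
split; first by exists (fun=> 0) => v; rewrite big1 // => i _; rewrite mul0r.
move=> e e0; exists 1 => // x y _ _.
by rewrite !subrr normr0 mulr_ge0 // ltW.
Qed.

Lemma strict_derivD f g z a b : strict_deriv f z a -> strict_deriv g z b ->
  strict_deriv (fun x => f x + g x) z (fun v => a v + b v).
Proof.
move=> [[c aE] fa] [[c' bE] gb]; split.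
  exists (fun i => c i + c' i) => v; rewrite aE bE -big_split /=.
  by apply: eq_bigr => i _; rewrite mulrDl.
move=> e e0; have e20 : 0 < e / 2 by rewrite divr_gt0.
have [d d0 fd] := fa _ e20; have [d' d'0 gd] := gb _ e20.
exists (Num.min d d') => [|x y]; first by rewrite lt_min d0.
rewrite !lt_min => /andP[xd xd'] /andP[yd yd'].
rewrite (_ : _ - _ = (f x - f y - a (x - y)) + (g x - g y - b (x - y)));
  last by ring.
rewrite [e]splitr mulrDl; apply: le_trans (ler_normD _ _) _.
by apply: lerD; [exact: fd|exact: gd].
Qed.

Lemma strict_derivM f g z a b : strict_deriv f z a -> strict_deriv g z b ->
  strict_deriv (fun x => f x * g x) z (fun v => a v * g z + f z * b v).
Proof.
move=> Hf Hg; have [Cf [df [Cf0 df0 fL]]] := strict_deriv_lipschitz Hf.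
have [Cg [dg [Cg0 dg0 gL]]] := strict_deriv_lipschitz Hg.
case: Hf Hg => la fa [lb gb].
split.
  case: la lb => c aE [c' bE]; exists (fun i => c i * g z + c' i * f z) => v.
  rewrite aE bE mulr_suml mulr_sumr -big_split /=.
  by apply: eq_bigr => i _; ring.
move=> e e0.
pose K := `|g z| + `|f z| + 2 * (Cf * Cg) + 1.
have K0 : 0 < K.
  by rewrite /K ltr_wpDl // !addr_ge0 // !mulr_ge0.
have [e' [e'0 e'1 e'K]] : exists e', [/\ 0 < e', e' <= 1 & e' <= e / K].
  exists (Num.min 1 (e / K)); rewrite lt_min ltr01 divr_gt0 //.
  by rewrite !ge_min !lexx orbT.
have [d1 d10 fd] := fa _ e'0; have [d2 d20 gd] := gb _ e'0.
pose d := Num.min (Num.min d1 d2) (Num.min (Num.min df dg) e').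
have d0 : 0 < d by rewrite /d !lt_min d10 d20 df0 dg0.
exists d => // x y xd yd.
have zz r : 0 < r -> `|z - z| < r by rewrite subrr normr0.
move: xd yd; rewrite /d !lt_min.
move=> /andP[/andP[x1 x2] /andP[/andP[xf xg] xe]].
move=> /andP[/andP[y1 y2] /andP[/andP[yf yg] ye]].
have fx := fd x y x1 y1; have gx := gd x y x2 y2.
set n0 := `|x - y| in fx gx *.
have n00 : 0 <= n0 by exact: normr_ge0.
rewrite (_ : _ - _ = (f x - f y - a (x - y)) * g z +
  f z * (g x - g y - b (x - y)) + (f x - f y) * (g x - g z) +
  (f y - f z) * (g x - g y)); last by ring.
have s1 : `|(f x - f y - a (x - y)) * g z| <= e' * n0 * `|g z|.
  by rewrite normrM ler_wpM2r.
have s2 : `|f z * (g x - g y - b (x - y))| <= `|f z| * (e' * n0).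
  by rewrite normrM ler_wpM2l.
have s3 : `|(f x - f y) * (g x - g z)| <= Cf * n0 * (Cg * e').
  rewrite normrM ler_pM //; first exact: fL.
  by apply: le_trans (gL _ _ xg (zz _ dg0)) _; rewrite ler_wpM2l // ltW.
have s4 : `|(f y - f z) * (g x - g y)| <= Cf * e' * (Cg * n0).
  rewrite normrM ler_pM //; last exact: gL.
  by apply: le_trans (fL _ _ yf (zz _ df0)) _; rewrite ler_wpM2l // ltW.
apply: le_trans (ler_normD _ _) _.
apply: le_trans (lerD (le_trans (ler_normD _ _) (lerD (ler_normD _ _) (lexx _)))
  (lexx _)) _.
apply: le_trans (lerD (lerD (lerD s1 s2) s3) s4) _.
rewrite (_ : _ + _ = e' * (K - 1) * n0); last by rewrite /K; ring.
rewrite ler_wpM2r //; apply: (@le_trans _ _ (e / K * K)).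
  apply: ler_pM => //; [exact: ltW| |by rewrite gerBl].
  by rewrite /K addrK !addr_ge0 // !mulr_ge0.
by rewrite divfK // gt_eqF.
Qed.

(** The mean value theorem, on the segment between the two coordinates. *)
Lemma strict_deriv_comp_coord (h : R -> R) (i : 'I_n) z :
  (\forall t \near z 0 i, derivable h t 1) ->
  {for z 0 i, continuous (derive1 h)} ->
  strict_deriv (fun x => h (x 0 i)) z (fun v => derive1 h (z 0 i) * v 0 i).
Proof.
move=> /nbhs_ballP[/= d0 d00 dh] ch; split.
  exists (fun j => derive1 h (z 0 i) * (j == i)%:R) => v.
  rewrite (bigD1 i) //= eqxx mulr1 big1 ?addr0 // => j /negPf ->.
  by rewrite mulr0 mul0r.
move=> e e0; move/cvgrPdist_le : ch => /(_ e e0)/nbhs_ballP[/= d1 d10 ch].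
exists (Num.min d0 d1) => [|x y]; first by rewrite lt_min d00.
set t := z 0 i.
suff H u w : u <= w -> `|u - t| < Num.min d0 d1 -> `|w - t| < Num.min d0 d1 ->
    `|h w - h u - derive1 h t * (w - u)| <= e * `|w - u|.
  move=> xz yz; rewrite !mxE.
  have cz v : `|v - z| < Num.min d0 d1 -> `|v 0 i - t| < Num.min d0 d1.
    by apply: le_lt_trans; have := coord_le_norm (v - z) i; rewrite !mxE.
  have cxy : e * `|x 0 i - y 0 i| <= e * `|x - y|.
    by rewrite ler_pM2l //; have := coord_le_norm (x - y) i; rewrite !mxE.
  have [xy|yx] := leP (y 0 i) (x 0 i).
    by apply: le_trans cxy; apply: H => //; exact: cz.
  apply: le_trans cxy; rewrite [in leRHS]distrC -[leLHS]normrN.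
  rewrite (_ : - (_ - _) = h (y 0 i) - h (x 0 i) - derive1 h t * (y 0 i - x 0 i)).
    by apply: H; [exact: ltW|exact: cz|exact: cz].
  by ring.
move=> uw; rewrite !lt_min => /andP[u0 u1] /andP[w0 w1].
have tB s (r : R) : `|u - t| < r -> `|w - t| < r -> s \in `[u, w] -> ball t r s.
  rewrite /ball /= => + + /itvP H; rewrite !ltr_norml => /andP[a1 a2] /andP[b1 b2].
  have [H1 H2] : u <= s /\ s <= w by rewrite !H.
  by apply/andP; split; lra.
have [||s sI ->] := @MVT_segment R h (derive1 h) u w uw.
- move=> s sI; apply: DeriveDef; last by rewrite derive1E.
  by apply: dh; apply: tB => //; exact: subset_itv_oo_cc.
- apply: derivable_within_continuous => s sI.
  by apply: dh; apply: tB.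
rewrite -mulrBl normrM ler_wpM2r // distrC; apply: ch; exact: tB.
Qed.
End strict_derivative.

(** * Sets with a small tangent space *)

Section tangent_kernel.
Variables (R : realType) (n : nat).
Local Notation V := 'rV[R]_n.

(** The tangent space of [Z] at [z], as the common kernel of the strict
    differentials of all functions that vanish on [Z]. *)
Definition tangent_to (Z : set V) (z v : V) : Prop :=
  forall f a, strict_deriv f z a -> (forall x, Z x -> f x = 0) -> a v = 0.

Let sphere : set V := [set v | `|v| = 1].

Let sphere_compact : compact sphere.
Proof.
apply: bounded_closed_compact.
  by exists 1; split => // x x1 v /= ->; exact: ltW.
rewrite (_ : sphere = Num.norm @^-1` [set 1]) //.
by apply: closed_comp => [v _|]; [exact: norm_continuous|exact: closed_eq].
Qed.

(** Otherwise there are pairs of points of [Z] that tend to [z] and whose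
    difference, once normalized, is almost killed by [ds]. By compactness of the
    unit sphere these directions have a cluster point [w]; every strict
    differential of a function that vanishes on [Z] kills [w], and so does [ds]. *)
Lemma tangent_lipschitz (Z : set V) z s ds : strict_deriv s z ds ->
  (forall v, tangent_to Z z v -> ds v = 0 -> v = 0) ->
  exists C d, [/\ 0 <= C, 0 < d & forall x y, Z x -> Z y ->
    `|x - z| < d -> `|y - z| < d -> `|x - y| <= C * `|s x - s y|].
Proof.
move=> sz ker; apply: contrapT => nL.
have /choice[xy xyP] : forall k : nat, exists xy : V * V,
    [/\ Z xy.1 /\ Z xy.2, `|xy.1 - z| < k.+1%:R^-1, `|xy.2 - z| < k.+1%:R^-1 &
     k.+1%:R * `|s xy.1 - s xy.2| < `|xy.1 - xy.2|].
  move=> k; apply: contrapT => nk; apply: nL; exists k.+1%:R, k.+1%:R^-1.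
  split => // x y Zx Zy xz yz; rewrite leNgt; apply/negP => lt.
  by apply: nk; exists (x, y).
pose u k := `|(xy k).1 - (xy k).2|^-1 *: ((xy k).1 - (xy k).2).
have n0 k : 0 < `|(xy k).1 - (xy k).2|.
  by have [_ _ _] := xyP k; apply: le_lt_trans; rewrite mulr_ge0.
have u1 k : sphere (u k).
  by rewrite /sphere /= normrZ normrV ?unitfE ?gt_eqF // normr_id mulVf // gt_eqF.
have [|w [w1 clw]] := sphere_compact (F := u @ \oo).
  by exists 0%N => // k _; exact: u1.
have uw e N : 0 < e -> exists2 k, (N <= k)%N & `|w - u k| < e.
  move=> e0; have /clw/(_ _) : (u @ \oo) (u @` [set k | (N <= k)%N]).
    by exists N => // k Nk; exists k.
  move=> /(_ (ball w e) (nbhsx_ballx _ _ e0))[_ [[k Nk <-]]].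
  by rewrite -ball_normE => uk; exists k.
(* This covers both the functions that vanish on [Z] and the function [s]. *)
have lim f a : strict_deriv f z a ->
    (forall k, k.+1%:R * `|f (xy k).1 - f (xy k).2| <= `|(xy k).1 - (xy k).2|) -> a w = 0.
  move=> [la fa] fk; have [C C0 aC] := linear_form_bound la.
  apply/eqP; rewrite -normr_le0; apply/ler_addgt0Pr => e e0; rewrite add0r.
  have e30 : 0 < e / 3 by rewrite divr_gt0.
  have [d d0 fd] := fa _ e30.
  have [N Nd] : exists N, N.+1%:R^-1 < Num.min d (e / 3).
    by apply: invS_lt; rewrite lt_min d0.
  move: Nd; rewrite lt_min => /andP[Nd Ne].
  have [k Nk wk] := uw (e / 3 / (C + 1)) N (divr_gt0 e30 (ltr_wpDl C0 ltr01)).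
  have kN : k.+1%:R^-1 <= N.+1%:R^-1 :> R by rewrite lef_pV2 ?posrE // ler_nat.
  have [_ xk yk _] := xyP k.
  have := fd _ _ (lt_trans (lt_le_trans xk kN) Nd) (lt_trans (lt_le_trans yk kN) Nd).
  set D := f _ - f _; set m := `|(xy k).1 - (xy k).2| => Hd.
  have m0 : 0 < m by exact: n0.
  have Dm : `|D| <= e / 3 * m.
    have := fk k; rewrite -ler_pdivlMl // => /le_trans; apply.
    by rewrite ler_wpM2r ?(ltW m0) //; apply: ltW; exact: le_lt_trans Ne.
  have au : `|a (u k)| <= e / 3 + e / 3.
    rewrite /u (linear_formZ _ _ la) normrM normrV ?unitfE ?gt_eqF // normr_id.
    rewrite mulrC ler_pdivrMr // -/m mulrDl.
    rewrite -(subKr D (a _)); apply: le_trans (ler_normB _ _) _.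
    by rewrite lerD.
  rewrite -(subrK (a (u k)) (a w)) -(linear_formB _ _ la).
  apply: le_trans (ler_normD _ _) _.
  rewrite (_ : e = e / 3 + (e / 3 + e / 3)); last by field.
  apply: lerD au; apply: le_trans (aC _) _.
  apply: (@le_trans _ _ ((C + 1) * (e / 3 / (C + 1)))).
    by apply: ler_pM => //; [rewrite lerDl|exact: ltW].
  by rewrite mulrC divfK // gt_eqF // ltr_wpDl.
have w0 : w = 0.
  apply: ker; last first.
    by apply: (lim s ds sz) => k; have [_ _ _ /ltW] := xyP k.
  move=> f a fa f0; apply: (lim f a fa) => k.
  by have [[Zx Zy] _ _ _] := xyP k; rewrite !f0 // subrr normr0 mulr0.
by move: w1; rewrite /sphere /= w0 normr0 => /eqP; rewrite eq_sym oner_eq0.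
Qed.

Let rat_ball (i : 'rV[rat]_n * nat) : set V :=
  [set x | `|x - map_mx ratr i.1| < i.2.+1%:R^-1].

Let rat_ball_basis z d : 0 < d ->
  exists2 i, rat_ball i z & forall x, rat_ball i x -> `|x - z| < d.
Proof.
move=> d0.
have [N Nd] : exists N, N.+1%:R^-1 < d / 2 by apply: invS_lt; rewrite divr_gt0.
have N0 : 0 < N.+1%:R^-1 :> R by rewrite invr_gt0.
have /choice[q qP] : forall j : 'I_n, exists q : rat,
    ratr q \in `]z 0 j - N.+1%:R^-1, z 0 j + N.+1%:R^-1[.
  move=> j; have [|q] := @rat_in_itvoo R (z 0 j - N.+1%:R^-1) (z 0 j + N.+1%:R^-1).
    by rewrite ltrBlDr -addrA ltrDl addr_gt0.
  by exists q.
have zq : rat_ball (\row_j q j, N) z.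
  have : ball z N.+1%:R^-1 (map_mx ratr (\row_j q j)).
    split => // i j; rewrite ord1 !mxE /ball /= ltr_norml.
    have := qP j; rewrite in_itv /=; move: (ratr _) (N.+1%:R^-1) => x r.
    by move=> /andP[? ?]; apply/andP; lra.
  by rewrite -ball_normE.
exists (\row_j q j, N) => // x xq.
rewrite -(subrKA (map_mx ratr (\row_j q j))) [d]splitr.
apply: le_lt_trans (ler_normD _ _) _; apply: ltrD; apply: lt_trans Nd => //.
by rewrite distrC.
Qed.

(** Locally [Z] is parametrized by [s] in a Lipschitz way, so its image is a
    Lipschitz curve; countably many rational balls suffice for the whole of [Z]. *)
Lemma negligible_tangent (Z : set V) (p q : V -> R) :
  (forall z, Z z -> exists s ds dp dq,
    [/\ strict_deriv s z ds, strict_deriv p z dp, strict_deriv q z dq &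
        forall v, tangent_to Z z v -> ds v = 0 -> v = 0]) ->
  (@line_measure R).-negligible ((fun z => (p z, q z)) @` Z).
Proof.
move=> H; pose G i := (fun z => (p z, q z)) @` (Z `&` rat_ball i).
pose F i : set (measurableTypeR R * measurableTypeR R) :=
  if pselect ((@line_measure R).-negligible (G i)) then G i else set0.
apply: (@negligibleS _ _ _ _ (\bigcup_i F i)); last first.
  apply: negligible_bigcup_countable => i; rewrite /F.
  by case: pselect => [//|?]; exact: negligible_set0.
move=> _ [z Zz <-]; have [s [ds [dp [dq [sz pz qz ker]]]]] := H z Zz.
have [C [d [C0 d0 Zd]]] := tangent_lipschitz sz ker.
have [Cs [d1 [Cs0 d10 sd]]] := strict_deriv_lipschitz sz.
have [Cp [d2 [Cp0 d20 pd]]] := strict_deriv_lipschitz pz.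
have [Cq [d3 [Cq0 d30 qd]]] := strict_deriv_lipschitz qz.
pose e := Num.min (Num.min d d1) (Num.min d2 d3).
have e0 : 0 < e by rewrite /e !lt_min d0 d10 d20 d30.
have [i iz id] := rat_ball_basis z e0.
have {}id x : rat_ball i x -> [/\ `|x - z| < d, `|x - z| < d1, `|x - z| < d2 & `|x - z| < d3].
  by move=> /id; rewrite /e !lt_min => /andP[/andP[-> ->] /andP[-> ->]].
exists i => //; rewrite /F; case: pselect => [?|[]]; first by exists z.
apply: (@negligible_lipschitz_image _ _ _ s p q (`|s z| + Cs * d1) (Num.max Cp Cq * C)).
- move=> x [_ /id[_ xd _ _]]; rewrite -(subrK (s z) (s x)) addrC.
  apply: le_trans (ler_normD _ _) _; rewrite lerD2l.
  apply: le_trans (sd _ _ xd _) _; first by rewrite subrr normr0.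
  by rewrite ler_wpM2l // ltW.
- move=> x y [Zx /id[xd _ xd2 _]] [Zy /id[yd _ yd2 _]].
  apply: le_trans (pd _ _ xd2 yd2) _; rewrite -mulrA.
  by apply: ler_pM => //; [rewrite le_max lexx|exact: Zd].
- move=> x y [Zx /id[xd _ _ xd2]] [Zy /id[yd _ _ yd2]].
  apply: le_trans (qd _ _ xd2 yd2) _; rewrite -mulrA.
  by apply: ler_pM => //; [rewrite le_max lexx orbT|exact: Zd].
Qed.
End tangent_kernel.

Section line_families.
Variable R : realType.

Section vector_valued.
Variable n : nat.
Local Notation V := 'rV[R]_n.
Implicit Types (P Q : V -> R * R) (z v : V).

Definition strict_deriv2 P z (dP : V -> R * R) :=
  strict_deriv (fst \o P) z (fst \o dP) /\
  strict_deriv (snd \o P) z (snd \o dP).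

Lemma strict_derivN (f : V -> R) z a : strict_deriv f z a ->
  strict_deriv (fun x => - f x) z (fun v => - a v).
Proof.
move=> fa; rewrite (_ : (fun x => - f x) = (fun x => -1 * f x)).
  apply: strict_deriv_eq (strict_derivM (strict_deriv_cst (-1) z) fa) => v /=.
  by rewrite mul0r add0r mulN1r.
by apply/funext => x; rewrite mulN1r.
Qed.

Lemma strict_derivB (f g : V -> R) z a b : strict_deriv f z a ->
  strict_deriv g z b -> strict_deriv (fun x => f x - g x) z (fun v => a v - b v).
Proof. by move=> fa /strict_derivN; exact: strict_derivD. Qed.

Lemma strict_deriv2_cst (p : R * R) z : strict_deriv2 (fun=> p) z (fun=> 0).
Proof. by split; exact: strict_deriv_cst. Qed.

Lemma strict_deriv2B P Q z dP dQ : strict_deriv2 P z dP -> strict_deriv2 Q z dQ ->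
  strict_deriv2 (fun x => P x - Q x) z (fun v => dP v - dQ v).
Proof. by move=> [p1 p2] [q1 q2]; split; exact: strict_derivB. Qed.

Lemma strict_deriv_dot P Q z dP dQ : strict_deriv2 P z dP ->
  strict_deriv2 Q z dQ -> strict_deriv (fun x => dot (P x) (Q x)) z
    (fun v => dot (dP v) (Q z) + dot (P z) (dQ v)).
Proof.
move=> [p1 p2] [q1 q2].
apply: strict_deriv_eq (strict_derivD (strict_derivM p1 q1) (strict_derivM p2 q2)).
by move=> v; rewrite /dot /=; ring.
Qed.

Lemma strict_deriv_cross P Q z dP dQ : strict_deriv2 P z dP ->
  strict_deriv2 Q z dQ -> strict_deriv (fun x => cross (P x) (Q x)) z
    (fun v => cross (dP v) (Q z) + cross (P z) (dQ v)).
Proof.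
move=> [p1 p2] [q1 q2].
apply: strict_deriv_eq (strict_derivB (strict_derivM p1 q2) (strict_derivM p2 q1)).
by move=> v; rewrite /cross /=; ring.
Qed.

Lemma strict_deriv_bisects P Q (T : V -> R * R) z dP dQ dT : strict_deriv2 P z dP ->
  strict_deriv2 Q z dQ -> strict_deriv2 T z dT ->
  strict_deriv (fun x => bisects (P x) (Q x) (T x)) z
    (fun v => dbisects (P z) (Q z) (T z) (dP v) (dQ v) (dT v)).
Proof.
move=> sP sQ sT; apply: strict_deriv_eq (strict_derivD
  (strict_derivM (strict_deriv_cross sP sT) (strict_deriv_dot sQ sT))
  (strict_derivM (strict_deriv_dot sP sT) (strict_deriv_cross sQ sT))).
by move=> v; rewrite /dbisects.
Qed.

Lemma strict_deriv_coord i z :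
  strict_deriv (fun x : V => x 0 i) z (fun v => v 0 i).
Proof.
have dE : derive1 (@id R) = fun=> 1.
  by apply/funext => t; rewrite derive1E derive_id.
apply: strict_deriv_eq (@strict_deriv_comp_coord R n id i z _ _).
- by move=> v; rewrite dE mul1r.
- by near=> t; exact: derivable_id.
- by rewrite dE; exact: cst_continuous.
Unshelve. all: by end_near. Qed.

Lemma strict_deriv2_curve g i z : analytic_curve_at g (z 0 i) ->
  strict_deriv2 (fun x => g (x 0 i)) z (fun v => v 0 i *: derive1 g (z 0 i)).
Proof.
move=> [/analytic_at_C1[d1 c1] /analytic_at_C1[d2 c2]].
have [_ ->] := derive1_pair (nbhs_singleton d1) (nbhs_singleton d2).
split.
  by apply: strict_deriv_eq (strict_deriv_comp_coord d1 c1) => v; exact: mulrC.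
by apply: strict_deriv_eq (strict_deriv_comp_coord d2 c2) => v; exact: mulrC.
Qed.

Lemma strict_deriv2_dir i z :
  strict_deriv2 (fun x => dir (x 0 i)) z (fun v => v 0 i *: dir' (z 0 i)).
Proof.
have dc : derive1 (@cos R) = fun t => - sin t.
  by apply/funext => t; rewrite derive1E derive_val.
have ds : derive1 (@sin R) = cos.
  by apply/funext => t; rewrite derive1E derive_val.
split.
  apply: strict_deriv_eq (@strict_deriv_comp_coord R n cos i z _ _).
  - by move=> v; rewrite dc /= mulrC.
  - by near=> t; exact: ex_derive.
  - by rewrite dc; apply: cvgN; exact: continuous_sin.
apply: strict_deriv_eq (@strict_deriv_comp_coord R n sin i z _ _).
- by move=> v; rewrite ds /= mulrC.
- by near=> t; exact: ex_derive.
- by rewrite ds; exact: continuous_cos.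
Unshelve. all: by end_near. Qed.

(** The line through [A z] of angle [z 0 i] has the offset
    [cross (dir (z 0 i)) (A z)]. *)
Lemma negligible_lines (Z : set V) (A : V -> R * R) (i : 'I_n) :
  (forall z, Z z -> exists s ds dA,
    [/\ strict_deriv s z ds, strict_deriv2 A z dA &
        forall v, tangent_to Z z v -> ds v = 0 -> v = 0]) ->
  (@line_measure R).-negligible
    ((fun z => (z 0 i, cross (dir (z 0 i)) (A z))) @` Z).
Proof.
move=> H; apply: negligible_tangent => z /H[s [ds [dA [sz Az ker]]]].
exists s, ds, (fun v => v 0 i); eexists; split => //.
  exact: strict_deriv_coord.
exact: strict_deriv_cross (strict_deriv2_dir i z) Az.
Qed.
End vector_valued.
End line_families.

(** * Three null families of lines *)

Section negligible_families.
Variable R : realType.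
Implicit Types (g : R -> R * R) (P A T d : R * R).

Lemma line_point_offset (l : R * R) A : (exists s, A = line_point l s) ->
  l = (l.1, cross (dir l.1) A).
Proof.
case: l => t p [s ->]; congr pair.
rewrite /cross /line_point /line_dir /= /GRing.scale /=.
rewrite -[LHS]mulr1 -(cos2Dsin2 t); ring.
Qed.

Let o0 : 'I_2 := ord0.
Let o1 : 'I_2 := ord_max.

Let row2_eq0 (v : 'rV[R]_2) : v 0 o0 = 0 -> v 0 o1 = 0 -> v = 0.
Proof.
move=> v0 v1; apply/rowP => -[[|[|//]] i]; rewrite mxE.
  by rewrite -[RHS]v0; congr (v 0 _); exact: val_inj.
by rewrite -[RHS]v1; congr (v 0 _); exact: val_inj.
Qed.

Let pt (t th : R) : 'rV[R]_2 := \row_i (if i == o0 then t else th).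
Let pt0 t th : pt t th 0 o0 = t. Proof. by rewrite mxE. Qed.
Let pt1 t th : pt t th 0 o1 = th. Proof. by rewrite mxE. Qed.

Definition lines_through P : set (R * R) :=
  [set l | exists s, P = line_point l s].

Lemma negligible_lines_through P :
  (@line_measure R).-negligible (lines_through P).
Proof.
apply: negligibleS (@negligible_lines R 1 setT (fun=> P) 0 _); last first.
  move=> z _; exists (fun x => x 0 0), (fun v => v 0 0), (fun=> 0).
  split; [exact: strict_deriv_coord|exact: strict_deriv2_cst|].
  by move=> v _ v0; apply/rowP => i; rewrite ord1 v0 mxE.
move=> l /line_point_offset ->; exists (\row_i l.1) => //=.
by rewrite !mxE.
Qed.

Definition tangent_lines g : set (R * R) :=
  [set l | exists t,
    [/\ analytic_curve_at g t, derive1 g t != 0,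
        cross (dir l.1) (derive1 g t) = 0 & lines_through (g t) l]].

(** The point of tangency determines the angle: turning a direction parallel to
    the nonzero vector [derive1 g t] makes it transversal at first order. *)
Lemma negligible_tangent_lines g :
  (@line_measure R).-negligible (tangent_lines g).
Proof.
pose Z := [set z : 'rV[R]_2 | [/\ analytic_curve_at g (z 0 o0),
  derive1 g (z 0 o0) != 0 & cross (dir (z 0 o1)) (derive1 g (z 0 o0)) = 0]].
apply: negligibleS (@negligible_lines R 2 Z (fun z => g (z 0 o0)) o1 _).
  move=> l [t [gt gt0 lt /line_point_offset lE]].
  by exists (pt t l.1); rewrite /Z /= pt0 pt1.
move=> z [gz gz0 dz]; exists (fun x => x 0 o0), (fun v => v 0 o0); eexists.
split; [exact: strict_deriv_coord|exact: strict_deriv2_curve|].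
move=> v Zv v0; apply: row2_eq0 => //.
have := Zv _ _ (strict_deriv_cross (strict_deriv2_dir o1 z)
   (strict_deriv2_curve (analytic_curve_derive gz).2)) (fun _ H => let: And3 _ _ e := H in e).
rewrite v0 scale0r => /eqP.
have -> (p q r : R * R) (k : R) : cross (k *: p) q + cross r 0 = k * cross p q.
  by rewrite crossZl /cross /= !mulr0 subrr addr0.
rewrite mulf_eq0 => /orP[/eqP //|/eqP].
have -> T : cross (dir' (z 0 o1)) T = - dot (dir (z 0 o1)) T.
  by case: T => ? ?; rewrite /cross /dot /=; ring.
move/eqP; rewrite oppr_eq0 (negPf (dot_neq0_parallel dz _ gz0)) //.
by rewrite dir_unit oner_neq0.
Qed.

(** The lines that meet the curve at some [g t] and whose reflection there passes
    through [P]. *)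
Definition lines_reflected_to g P : set (R * R) :=
  [set l | exists t,
    [/\ analytic_curve_at g t, derive1 g t != 0, P != g t,
        bisects (P - g t) (dir l.1) (derive1 g t) = 0 & lines_through (g t) l]].

(** The point [g t] determines the direction: [bisects W d T] and its derivative
    when [d] turns are the imaginary and, up to sign, the real part of the same
    nonzero complex number, so they do not vanish together. *)
Lemma negligible_lines_reflected_to g P :
  (@line_measure R).-negligible (lines_reflected_to g P).
Proof.
pose Z := [set z : 'rV[R]_2 | [/\ analytic_curve_at g (z 0 o0),
  derive1 g (z 0 o0) != 0, P != g (z 0 o0) &
  bisects (P - g (z 0 o0)) (dir (z 0 o1)) (derive1 g (z 0 o0)) = 0]].
apply: negligibleS (@negligible_lines R 2 Z (fun z => g (z 0 o0)) o1 _).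
  move=> l [t [gt gt0 Pt lt /line_point_offset lE]].
  by exists (pt t l.1); rewrite /Z /= pt0 pt1.
move=> z [gz gz0 Pz dz]; exists (fun x => x 0 o0), (fun v => v 0 o0); eexists.
split; [exact: strict_deriv_coord|exact: strict_deriv2_curve|].
move=> v Zv v0; apply: row2_eq0 => //.
have sQ := strict_deriv2_dir o1 z.
have sT := strict_deriv2_curve (analytic_curve_derive gz).2.
have sP := strict_deriv2B (strict_deriv2_cst P z) (strict_deriv2_curve gz).
have := Zv _ _ (strict_deriv_bisects sP sQ sT)
  (fun _ H => let: And4 _ _ _ e := H in e).
rewrite v0 dbisects_turn; move: dz Pz; rewrite -subr_eq0.
move: (P - _) (derive1 g _) gz0 (z 0 o1) (v 0 o1) => W T T0 th k dz W0 /eqP.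
rewrite mulf_eq0 => /orP[/eqP //|/eqP B0].
suff /eqP : dot W W * dot T T ^+ 2 = 0.
  by rewrite mulf_eq0 expf_eq0 /= !(negPf (dot_self_neq0 _)).
transitivity (bisects W (dir th) T ^+ 2 + bisects W (dir' th) T ^+ 2); last first.
  by rewrite dz B0 expr0n addr0.
have cs : cos th ^+ 2 = 1 - sin th ^+ 2 by rewrite -(cos2Dsin2 th) addrK.
case: (W) (T) => [x y] [a b].
by rewrite /bisects /cross /dot /=; ring: cs.
Qed.
End negligible_families.

(** * Infinitesimal rigidity of reflecting triangles *)

Section mirror_equation.
Variable R : realType.
Implicit Types (P Q T U X r v w : R * R) (m s c : R).

(** Let [r] join [A2] to [A1], let [U] and [T] be the velocities at [A1] and [A2]
    and [X] the acceleration at [A2]. The normal at [A2] and the tangent at [A1]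
    meet at the distance [h] of [A2] proportional to [cross r U / dot U T]; the
    equation says, denominators cleared, that the curvature at [A2] is
    [sin a ^ 2 / h], where [a] is the angle between [r] and [T]. *)
Definition mirror_eqn r T U X : R :=
  cross r T ^+ 2 * dot U T + cross r U * cross T X * dot r r.

(** The derivative of [mirror_eqn] along the arc of [A1], with acceleration [U'] at
    [A1]: then [r] has the derivative [U]. *)
Definition dmirror_eqn r T U X U' : R :=
  2 * cross r T * cross U T * dot U T + cross r T ^+ 2 * dot U' T +
  (cross r U' * dot r r + cross r U * (2 * dot r U)) * cross T X.

Section triangle.
Variables (a b e f : R).
Let v1 : R * R := (a, b).
Let v2 : R * R := (e, f).
Variables (d T1 T2 r U1 U2 : R * R) (s1 s2 c m1 m2 : R).
Hypotheses (v1_unit : dot v1 v1 = 1) (v2_unit : dot v2 v2 = 1).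
Hypotheses (d_unit : dot d d = 1) (triangle : c *: d = s1 *: v1 + s2 *: v2).
Hypotheses (T1E : T1 = m1 *: (v1 + d)) (T2E : T2 = m2 *: (v1 + v2)).
Hypotheses (s1_gt0 : 0 < s1) (s2_gt0 : 0 < s2) (c_gt0 : 0 < c).
Hypothesis rE : r = - s1 *: v1.
Hypothesis curv1 : 2 * s1 * c * cross T1 U1 =
   dot T1 T1 * cross T1 v1 * (c + s2 - s1).
Hypothesis curv2 : 2 * s1 * s2 * cross T2 U2 =
   - (dot T2 T2 * cross T2 v1 * (s1 + s2 + c)).

Let w := dot v1 v2.
Let k := cross v1 v2.
Let dE : d = c^-1 *: (s1 *: v1 + s2 *: v2).
Proof. by rewrite -triangle scalerA mulVf ?scale1r // gt_eqF. Qed.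
Let s1n0 : s1 != 0. Proof. by rewrite gt_eqF. Qed.
Let s2n0 : s2 != 0. Proof. by rewrite gt_eqF. Qed.
Let cn0 : c != 0. Proof. by rewrite gt_eqF. Qed.

Let dot11 : a ^+ 2 = 1 - b ^+ 2.
Proof. by rewrite -v1_unit /dot /v1 /=; ring. Qed.
Let dot22 : e ^+ 2 = 1 - f ^+ 2.
Proof. by rewrite -v2_unit /dot /v2 /=; ring. Qed.

Ltac expand := rewrite ?T1E ?T2E ?dE ?rE /w /k /v1 /v2 /dot /cross /= /GRing.scale /=.

Let k_sqr : k ^+ 2 = (1 - w) * (1 + w).
Proof. by expand; ring: dot11 dot22. Qed.
Let c_sqr : c ^+ 2 = s1 ^+ 2 + s2 ^+ 2 + 2 * s1 * s2 * w.
Proof.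
have -> : c ^+ 2 = dot (c *: d) (c *: d).
  by rewrite -[LHS]mulr1 -d_unit; case: (d) => ? ?; rewrite /dot /= /GRing.scale /=; ring.
by rewrite triangle; expand; ring: dot11 dot22.
Qed.

Let rT2 : cross r T2 = - s1 * m2 * k. Proof. by expand; ring. Qed.
Let T2v : cross T2 v1 = - m2 * k. Proof. by expand; ring. Qed.
Let T1v : cross T1 v1 = - m1 * s2 * k / c. Proof. by expand; field. Qed.
Let rT1 : cross r T1 = - s1 * m1 * s2 * k / c. Proof. by expand; field. Qed.
Let rr : dot r r = s1 ^+ 2. Proof. by expand; ring: dot11. Qed.
Let T2T2 : dot T2 T2 = 2 * m2 ^+ 2 * (1 + w).
Proof. by expand; ring: dot11 dot22. Qed.
Let T1T1 : dot T1 T1 = 2 * m1 ^+ 2 * (c + s1 + s2 * w) / c.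
Proof.
have -> : dot T1 T1 = m1 ^+ 2 * (dot v1 v1 + dot d d + 2 * dot v1 d).
  by rewrite T1E; case: (d) => ? ?; rewrite /v1 /dot /= /GRing.scale /=; ring.
rewrite v1_unit d_unit; expand.
have -> : a * (c^-1 * (s1 * a + s2 * e)) + b * (c^-1 * (s1 * b + s2 * f)) =
  (s1 * dot v1 v1 + s2 * dot v1 v2) / c by expand; ring.
by rewrite v1_unit; expand; field.
Qed.
Let T1T2 : dot T1 T2 = m1 * m2 * (1 + w) * (s1 + s2 + c) / c.
Proof.
have -> : dot T1 T2 = m1 * m2 / c *
    (c * dot v1 v1 + c * w + s1 * dot v1 v1 + s2 * dot v2 v2 + (s1 + s2) * w).
  by expand; field.
by rewrite v1_unit v2_unit; field.
Qed.
Let T1xT2 : cross T1 T2 = m1 * m2 * k * (c + s1 - s2) / c.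
Proof. by expand; field. Qed.
Let rdT1 : dot r T1 = - s1 * m1 * (c + s1 + s2 * w) / c.
Proof.
have -> : dot r T1 = - s1 * m1 / c * (c * dot v1 v1 + s1 * dot v1 v1 + s2 * w).
  by expand; field.
by rewrite v1_unit; field.
Qed.
Let K2 : cross T2 U2 = m2 ^+ 3 * (1 + w) * k * (s1 + s2 + c) / (s1 * s2).
Proof.
have n0 : 2 * s1 * s2 != 0 by rewrite !mulf_neq0 // pnatr_eq0.
by apply: (mulfI n0); rewrite curv2 T2v T2T2; field; rewrite s1n0 s2n0.
Qed.
(** Every quantity is expressed in terms of the lengths of the sides and of the dot
    and cross products [w] and [k] of the first two directions. *)
Lemma mirror_eq0 : mirror_eqn r T2 T1 U2 = 0.
Proof.
by rewrite /mirror_eqn rT2 T1T2 rT1 K2 rr; field; rewrite cn0 s1n0 s2n0.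
Qed.
Let K1 : m1 != 0 -> cross T1 U1 =
  - m1 ^+ 3 * s2 * k * (c + s1 + s2 * w) * (c + s2 - s1) / (s1 * c ^+ 3).
Proof.
have n0 : 2 * s1 * c != 0 by rewrite !mulf_neq0 // pnatr_eq0.
by move=> m1n0; apply: (mulfI n0); rewrite curv1 T1v T1T1; field; rewrite s1n0 cn0.
Qed.

(** By the law of cosines and the two curvature relations, the derivative collapses
    to a single product. It cannot vanish because [k ^+ 2 = (1 - w) * (1 + w)]. *)
Lemma dmirror_neq0 : m1 != 0 -> m2 != 0 -> k != 0 ->
  dmirror_eqn r T2 T1 U2 U1 != 0.
Proof.
move=> m1n0 m2n0 kn0.
have w1 : 1 + w != 0.
  by apply: contra_neq kn0 => w1; apply/eqP; rewrite -sqrf_eq0 k_sqr w1 mulr0.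
have e0 : c + s1 + s2 * w != 0.
  apply: contra_neq kn0 => e0; apply/eqP.
  have /eqP : (s2 * k) ^+ 2 = 0.
    have -> : (s2 * k) ^+ 2 = (c + s1 + s2 * w) * (c - s1 - s2 * w).
      by ring: k_sqr c_sqr.
    by rewrite e0 mul0r.
  by rewrite sqrf_eq0 mulf_eq0 (negPf s2n0).
suff -> : dmirror_eqn r T2 T1 U2 U1 = 3 * m1 ^+ 2 * m2 ^+ 3 * s1 * s2 * k ^+ 2 *
    (1 + w) ^+ 2 * (s1 + s2 + c) / c ^+ 2.
  by rewrite !mulf_neq0 ?invr_eq0 ?expf_neq0 ?pnatr_eq0 // gt_eqF ?addr_gt0.
have T1n0 : dot T1 T1 != 0.
  by rewrite T1T1 !mulf_neq0 ?invr_eq0 ?expf_neq0 // pnatr_eq0.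
(* The component of [U1] along [T1] only contributes a multiple of [mirror_eqn],
   which vanishes; the orthogonal component is the curvature. *)
have U1T2 : dot U1 T2 = (dot T1 U1 * dot T1 T2 + cross T1 U1 * cross T1 T2) / dot T1 T1.
  apply: (canRL (mulfK T1n0)).
  case: (U1) (T1) (T2) (r) => [? ?] [? ?] [? ?] [? ?].
  by rewrite /dot /cross /=; ring.
have rU1 : cross r U1 = (dot T1 U1 * cross r T1 + cross T1 U1 * dot r T1) / dot T1 T1.
  apply: (canRL (mulfK T1n0)).
  case: (U1) (T1) (T2) (r) => [? ?] [? ?] [? ?] [? ?].
  by rewrite /dot /cross /=; ring.
transitivity (2 * cross r T2 * cross T1 T2 * dot T1 T2 +
   dot T1 U1 / dot T1 T1 * mirror_eqn r T2 T1 U2 +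
   cross T1 U1 / dot T1 T1 *
     (cross r T2 ^+ 2 * cross T1 T2 + cross T2 U2 * dot r T1 * dot r r)
   + 2 * cross T2 U2 * cross r T1 * dot r T1).
  by rewrite /dmirror_eqn /mirror_eqn U1T2 rU1; field.
have wE : w = (c ^+ 2 - s1 ^+ 2 - s2 ^+ 2) / (2 * s1 * s2).
  by rewrite c_sqr; field; rewrite s1n0 s2n0.
rewrite mirror_eq0 K1 // T1T1 rT2 T1xT2 T1T2 K2 rdT1 rr rT1.
rewrite mulr0 addr0.
set lhs := LHS.
transitivity (2 * m1 ^+ 2 * m2 ^+ 3 * k ^+ 2 * (
   - s1 * (1 + w) * (s1 + s2 + c) * (c + s1 - s2) / c ^+ 2
   - s1 * s2 * k ^+ 2 * (c + s2 - s1) * (c + s1 - s2) / (4 * c ^+ 3)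
   + s1 * (1 + w) * (s1 + s2 + c) * (c + s1 + s2 * w) * (c + s2 - s1) / (4 * c ^+ 3)
   + s1 * (1 + w) * (s1 + s2 + c) * (c + s1 + s2 * w) / c ^+ 2)).
  by rewrite /lhs; field; rewrite s1n0 s2n0 cn0 m1n0 e0.
by rewrite k_sqr wE; field; rewrite s1n0 s2n0 cn0.
Qed.
End triangle.
End mirror_equation.

Section reflecting_triangles.
Variable R : realType.
Implicit Types (A T U d v : R * R) (s c m x : R).

(** The triangle cut out by a line of direction [d] with three reflections. The
    directions of the rays are [d], [v1], [v2] and again [d]; a mirror is parallel
    to the sum of the two directions it exchanges, with a factor [mi] that accounts
    for the speed of the arc. *)
Record reflecting_triangle A1 A2 A3 T1 T2 T3 d v1 v2 s1 s2 c m1 m2 m3 : Prop :=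
  ReflectingTriangle {
    side1_unit : dot v1 v1 = 1;
    side2_unit : dot v2 v2 = 1;
    side3_unit : dot d d = 1;
    side1_gt0 : 0 < s1;
    side2_gt0 : 0 < s2;
    side3_gt0 : 0 < c;
    side1E : A2 - A1 = s1 *: v1;
    side2E : A3 - A2 = s2 *: v2;
    side3E : A3 - A1 = c *: d;
    mirror1E : T1 = m1 *: (v1 + d);
    mirror2E : T2 = m2 *: (v1 + v2);
    mirror3E : T3 = m3 *: (v2 + d);
    mirror1_neq0 : m1 != 0;
    mirror2_neq0 : m2 != 0;
    mirror3_neq0 : m3 != 0;
    nondegenerate : cross v1 d != 0
  }.

Section infinitesimal.
Variables (A1 A2 A3 T1 T2 T3 d v1 v2 : R * R) (s1 s2 c m1 m2 m3 : R).
Hypothesis tri : reflecting_triangle A1 A2 A3 T1 T2 T3 d v1 v2 s1 s2 c m1 m2 m3.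
Variables (U1 U2 : R * R) (x1 x2 x3 : R).

Let chi1 := cross T1 v1.
Let chi2 := cross T2 v1.
Let chi3 := cross T3 d.

(** Up to nonzero factors, these are the minors of the two linearized reflection
    laws in the speeds of [A1] and [A3], respectively of [A2] and [A3]. Each is
    affine in a curvature, so that its vanishing prescribes this curvature. *)
Definition defect1 := 2 * s1 * c * cross T1 U1 - dot T1 T1 * chi1 * (c + s2 - s1).
Definition defect2 := 2 * s1 * s2 * cross T2 U2 + dot T2 T2 * chi2 * (s1 + s2 + c).

Let triangleE : c *: d = s1 *: v1 + s2 *: v2.
Proof.
by rewrite -(side1E tri) -(side2E tri) -(side3E tri) [RHS]addrC subrKA.
Qed.

Let cross_bisector T m v w : T = m *: (v + w) -> cross T w = - cross T v.
Proof.
by move->; case: v w => [? ?] [? ?]; rewrite /cross /= /GRing.scale /=; ring.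
Qed.

Let crossZB x y (a b w : R * R) :
  cross (x *: a - y *: b) w = x * cross a w - y * cross b w.
Proof.
by case: a b w => [? ?] [? ?] [? ?]; rewrite /cross /= /GRing.scale /=; ring.
Qed.

Let crossZr x (a b : R * R) : cross a (x *: b) = x * cross a b.
Proof. by case: a b => [? ?] [? ?]; rewrite /cross /= /GRing.scale /=; ring. Qed.

(** The linearized reflection laws at [A1] and [A2], when the vertices move with
    speeds [x1], [x2], [x3] along arcs with accelerations [U1], [U2]. *)
Definition dreflection1 := dbisects (A2 - A1) (A3 - A1) T1
    (x2 *: T2 - x1 *: T1) (x3 *: T3 - x1 *: T1) (x1 *: U1).
Definition dreflection2 := dbisects (A1 - A2) (A3 - A2) T2
    (x1 *: T1 - x2 *: T2) (x3 *: T3 - x2 *: T2) (x2 *: U2).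

Let dreflection1E : dreflection1 =
  dot T1 T1 * (c * (x2 * chi2 - x1 * chi1) + s1 * (x3 * chi3 + x1 * chi1)) +
  2 * s1 * c * (x1 * cross T1 U1).
Proof.
rewrite /dreflection1 (dbisects_linear _ _ _ (side1_unit tri) (side3_unit tri)
  (mirror1E tri) (side1E tri) (side3E tri)) !crossZB crossZr.
by rewrite (cross_bisector (mirror1E tri)) mulrN opprK.
Qed.

Let dreflection2E : dreflection2 =
  dot T2 T2 * (s2 * (x1 * chi1 - x2 * chi2) + s1 * (x3 * chi3 - x2 * chi2)) -
  2 * s1 * s2 * (x2 * cross T2 U2).
Proof.
have side1N : A1 - A2 = - s1 *: v1 by rewrite scaleNr -(side1E tri) opprB.
rewrite /dreflection2 (dbisects_linear _ _ _ (side1_unit tri) (side2_unit tri)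
  (mirror2E tri) side1N (side2E tri)) !crossZB crossZr.
rewrite (cross_bisector (mirror2E tri)).
rewrite /chi3 (cross_bisector (mirror3E tri)).
by rewrite /chi1 /chi2; ring.
Qed.

Let side_cross : s2 * cross v1 v2 = c * cross v1 d.
Proof.
rewrite -[RHS]crossZr triangleE.
by case: (v1) (v2) => [? ?] [? ?]; rewrite /cross /= /GRing.scale /=; ring.
Qed.

Let side_cross' : s1 * cross v1 d = s2 * cross d v2.
Proof.
have cn0 : c != 0 by rewrite gt_eqF ?(side3_gt0 tri).
apply: (mulfI cn0).
have -> : c * (s1 * cross v1 d) = s1 * cross v1 (c *: d) by rewrite crossZr; ring.
have -> : c * (s2 * cross d v2) = s2 * cross (c *: d) v2 by rewrite crossZl; ring.
rewrite triangleE.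
by case: (v1) (v2) => [? ?] [? ?]; rewrite /cross /= /GRing.scale /=; ring.
Qed.

Lemma cross_sides_neq0 : cross v1 v2 != 0.
Proof.
apply: contra_neq (nondegenerate tri) => e; apply/eqP.
move: side_cross; rewrite e mulr0 => /esym/eqP.
by rewrite mulf_eq0 gt_eqF ?(side3_gt0 tri).
Qed.

Let cross_neq0 (a b : R * R) : cross a b != 0 -> a != 0.
Proof. by apply: contra_neq => ->; rewrite /cross /= !mul0r subrr. Qed.

Let chi2_neq0 : chi2 != 0.
Proof.
rewrite /chi2 (mirror2E tri) crossZl crossDl crossvv add0r mulf_neq0 ?(mirror2_neq0 tri) //.
have -> : cross v2 v1 = - cross v1 v2 by rewrite /cross; ring.
by rewrite oppr_eq0 cross_sides_neq0.
Qed.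

Let chi3_neq0 : chi3 != 0.
Proof.
rewrite /chi3 (mirror3E tri) crossZl crossDl crossvv addr0 mulf_neq0 ?(mirror3_neq0 tri) //.
have := nondegenerate tri; apply: contra_neq => e; apply/eqP.
have /eqP := side_cross'; have -> : cross d v2 = - cross v2 d by rewrite /cross; ring.
by rewrite e oppr0 mulr0 mulf_eq0 gt_eqF ?(side1_gt0 tri).
Qed.

Let T2_neq0 : dot T2 T2 != 0.
Proof. exact/dot_self_neq0/(cross_neq0 chi2_neq0). Qed.

Let T1_neq0 : dot T1 T1 != 0.
Proof.
apply: dot_self_neq0; apply: (@cross_neq0 _ d).
rewrite (mirror1E tri) crossZl crossDl crossvv addr0 mulf_neq0 ?(mirror1_neq0 tri) //.
exact: nondegenerate tri.
Qed.

Let s1n0 : s1 != 0. Proof. by rewrite gt_eqF ?(side1_gt0 tri). Qed.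

(** The law at [A1] determines [x3] from [x2] (as [T3] is transversal to the
    line), and inserting this into the law at [A2] gives [x2 * defect2 = 0]. *)
Lemma rigid_fixing1 : defect2 != 0 -> x1 = 0 ->
  dreflection1 = 0 -> dreflection2 = 0 -> x2 = 0 /\ x3 = 0.
Proof.
move=> def x10; rewrite dreflection1E dreflection2E x10.
move=> /eqP; rewrite !mul0r subr0 addr0 mulr0 addr0 mulf_eq0 (negPf T1_neq0) /=.
rewrite addrC addr_eq0 => /eqP e1 e2.
have x20 : x2 = 0.
  apply/eqP; rewrite -[_ == _]orbF -(negPf def) -mulf_eq0; apply/eqP.
  rewrite -[RHS]oppr0 -e2 /defect2.
  rewrite (_ : s1 * (_ - _) = s1 * (x3 * chi3) - s1 * (x2 * chi2)); last by ring.
  by rewrite e1; ring.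
split => //; move/eqP: e1; rewrite x20 mul0r mulr0 oppr0.
by rewrite !mulf_eq0 (negPf s1n0) (negPf chi3_neq0) orbF => /eqP.
Qed.

(** As before, with the roles of the two laws exchanged. *)
Lemma rigid_fixing2 : defect1 != 0 -> x2 = 0 ->
  dreflection1 = 0 -> dreflection2 = 0 -> x1 = 0 /\ x3 = 0.
Proof.
move=> def x20; rewrite dreflection1E dreflection2E x20.
move=> e1 /eqP; rewrite !mul0r !subr0 mulr0 subr0 mulf_eq0 (negPf T2_neq0) /=.
rewrite addrC addr_eq0 => /eqP e2.
have x10 : x1 = 0.
  apply/eqP; rewrite -[_ == _]orbF -(negPf def) -mulf_eq0; apply/eqP.
  rewrite -e1 /defect1 mul0r sub0r.
  rewrite (_ : s1 * (_ + _) = s1 * (x3 * chi3) + s1 * (x1 * chi1)); last by ring.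
  by rewrite e2; ring.
split => //; move/eqP: e2; rewrite x10 mul0r mulr0 oppr0.
by rewrite !mulf_eq0 (negPf s1n0) (negPf chi3_neq0) orbF => /eqP.
Qed.

Let rE : A1 - A2 = - s1 *: v1.
Proof. by rewrite scaleNr -(side1E tri) opprB. Qed.

Let defect1_eq0 : defect1 = 0 ->
  2 * s1 * c * cross T1 U1 = dot T1 T1 * cross T1 v1 * (c + s2 - s1).
Proof. by move/eqP; rewrite subr_eq0 => /eqP. Qed.
Let defect2_eq0 : defect2 = 0 ->
  2 * s1 * s2 * cross T2 U2 = - (dot T2 T2 * cross T2 v1 * (s1 + s2 + c)).
Proof. by move/eqP; rewrite addr_eq0 => /eqP. Qed.

Lemma defect_mirror : defect2 = 0 -> mirror_eqn (A1 - A2) T2 T1 U2 = 0.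
Proof.
move=> /defect2_eq0; rewrite rE.
move: triangleE (mirror1E tri) (mirror2E tri) (side1_unit tri) (side2_unit tri).
move: (side3_unit tri) (side1_gt0 tri) (side2_gt0 tri) (side3_gt0 tri).
case: (v1) (v2) => [a b] [e f] *.
by apply: (@mirror_eq0 R a b e f d T1 T2 _ U2 s1 s2 c m1 m2).
Qed.

Lemma defect_dmirror : defect1 = 0 -> defect2 = 0 ->
  dmirror_eqn (A1 - A2) T2 T1 U2 U1 != 0.
Proof.
move=> /defect1_eq0 + /defect2_eq0; rewrite rE.
have := cross_sides_neq0; have := mirror1_neq0 tri; have := mirror2_neq0 tri.
move: triangleE (mirror1E tri) (mirror2E tri) (side1_unit tri) (side2_unit tri).
move: (side3_unit tri) (side1_gt0 tri) (side2_gt0 tri) (side3_gt0 tri).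
case: (v1) (v2) => [a b] [e f] *.
by apply: (@dmirror_neq0 R a b e f d T1 T2 _ U1 U2 s1 s2 c m1 m2).
Qed.

(** When both laws are dependent, the derivative of [mirror_eqn] takes the place of
    the law at [A1]. *)
Lemma rigid_curvature : defect1 = 0 -> defect2 = 0 -> x2 = 0 ->
  x1 * dmirror_eqn (A1 - A2) T2 T1 U2 U1 = 0 -> dreflection2 = 0 ->
  x1 = 0 /\ x3 = 0.
Proof.
move=> d1 d2 x20 /eqP; rewrite mulf_eq0 (negPf (defect_dmirror d1 d2)) orbF.
move=> /eqP x10 /eqP; rewrite dreflection2E x20 x10.
rewrite !mul0r !subr0 !mulr0 add0r subr0 !mulf_eq0 (negPf T2_neq0).
by rewrite (negPf s1n0) (negPf chi3_neq0) orbF => /eqP.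
Qed.
End infinitesimal.
End reflecting_triangles.

(** * Lines that close up after three reflections *)

Section triangle_lines.
Variable R : realType.
Variables g1 g2 g3 : R -> R * R.

(* The coordinates are the parameters of the three vertices and the angle of the
   line. *)
Let V := 'rV[R]_4.
Let i1 : 'I_4 := @Ordinal 4 0 isT.
Let i2 : 'I_4 := @Ordinal 4 1 isT.
Let i3 : 'I_4 := @Ordinal 4 2 isT.
Let i4 : 'I_4 := @Ordinal 4 3 isT.

Let row4_eq0 (v : V) : v 0 i1 = 0 -> v 0 i2 = 0 -> v 0 i3 = 0 -> v 0 i4 = 0 ->
  v = 0.
Proof.
move=> e1 e2 e3 e4; apply/rowP => -[[|[|[|[|//]]]] i]; rewrite mxE;
  [rewrite -[RHS]e1|rewrite -[RHS]e2|rewrite -[RHS]e3|rewrite -[RHS]e4];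
  by congr (v 0 _); exact: val_inj.
Qed.

Let triangle_at (z : V) :=
  reflecting_triangle (g1 (z 0 i1)) (g2 (z 0 i2)) (g3 (z 0 i3))
   (derive1 g1 (z 0 i1)) (derive1 g2 (z 0 i2)) (derive1 g3 (z 0 i3))
   (dir (z 0 i4)).

Let analytic_z (z : V) := [/\ analytic_curve_at g1 (z 0 i1),
  analytic_curve_at g2 (z 0 i2) & analytic_curve_at g3 (z 0 i3)].

Let Z : set V := [set z | analytic_z z /\ exists v1 v2 s1 s2 c m1 m2 m3,
   triangle_at z v1 v2 s1 s2 c m1 m2 m3].

Let closing_eq0 (z : V) : Z z ->
  cross (g3 (z 0 i3) - g1 (z 0 i1)) (dir (z 0 i4)) = 0.
Proof.
move=> [_ [v1 [v2 [s1 [s2 [c [m1 [m2 [m3 tri]]]]]]]]].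
by rewrite (side3E tri) crossZl crossvv mulr0.
Qed.

Let bisects_unit (v w : R * R) (k s c : R) : dot v v = 1 -> dot w w = 1 ->
  bisects (s *: v) (c *: w) (k *: (v + w)) = 0.
Proof.
rewrite /bisects /cross /dot; case: v w => [a b] [e f].
rewrite /= /GRing.scale /= => ab ef.
have {}ab : a ^+ 2 = 1 - b ^+ 2 by rewrite -ab; ring.
have {}ef : e ^+ 2 = 1 - f ^+ 2 by rewrite -ef; ring.
ring: ab ef.
Qed.

Let reflection1 (z : V) := bisects (g2 (z 0 i2) - g1 (z 0 i1))
  (g3 (z 0 i3) - g1 (z 0 i1)) (derive1 g1 (z 0 i1)).
Let reflection2 (z : V) := bisects (g1 (z 0 i1) - g2 (z 0 i2))
  (g3 (z 0 i3) - g2 (z 0 i2)) (derive1 g2 (z 0 i2)).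

Let reflection1_eq0 z : Z z -> reflection1 z = 0.
Proof.
move=> [_ [v1 [v2 [s1 [s2 [c [m1 [m2 [m3 tri]]]]]]]]].
rewrite /reflection1 (side1E tri) (side3E tri) (mirror1E tri).
by rewrite (bisects_unit _ _ _ (side1_unit tri) (side3_unit tri)).
Qed.

Let reflection2_eq0 z : Z z -> reflection2 z = 0.
Proof.
move=> [_ [v1 [v2 [s1 [s2 [c [m1 [m2 [m3 tri]]]]]]]]].
have side1N : g1 (z 0 i1) - g2 (z 0 i2) = - s1 *: v1.
  by rewrite scaleNr -(side1E tri) opprB.
rewrite /reflection2 side1N (side2E tri) (mirror2E tri).
by rewrite (bisects_unit _ _ _ (side1_unit tri) (side2_unit tri)).
Qed.

Let dmirrorE (r T1' T2' U1' U2' W : R * R) (x : R) :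
  x * dmirror_eqn r T2' T1' U2' U1' =
  ((cross (x *: T1' - 0 *: T2') T2' + cross r (0 *: U2')) * cross r T2' +
   cross r T2' * (cross (x *: T1' - 0 *: T2') T2' + cross r (0 *: U2'))) *
     dot T1' T2' +
  cross r T2' * cross r T2' * (dot (x *: U1') T2' + dot T1' (0 *: U2')) +
  (((cross (x *: T1' - 0 *: T2') T1' + cross r (x *: U1')) * cross T2' U2' +
    cross r T1' * (cross (0 *: U2') U2' + cross T2' (0 *: W))) * dot r r +
   cross r T1' * cross T2' U2' *
     (dot (x *: T1' - 0 *: T2') r + dot r (x *: T1' - 0 *: T2'))).
Proof.
rewrite /dmirror_eqn; case: r T1' T2' U1' U2' W => [? ?] [? ?] [? ?] [? ?] [? ?] [? ?].
by rewrite /cross /dot /= /GRing.scale /=; ring.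
Qed.

Section tangent_space.
Variables (z v : V) (v1 v2 : R * R) (s1 s2 c m1 m2 m3 : R).
Hypothesis az : analytic_z z.
Hypothesis tri : triangle_at z v1 v2 s1 s2 c m1 m2 m3.
Variable Z' : set V.
Hypothesis Z'Z : Z' `<=` Z.
Hypothesis Zv : tangent_to Z' z v.

Let az1 : analytic_curve_at g1 (z 0 i1). Proof. by case: az. Qed.
Let az2 : analytic_curve_at g2 (z 0 i2). Proof. by case: az. Qed.
Let az3 : analytic_curve_at g3 (z 0 i3). Proof. by case: az. Qed.
Let T1 := derive1 g1 (z 0 i1).
Let T2 := derive1 g2 (z 0 i2).
Let T3 := derive1 g3 (z 0 i3).
Let U1 := derive1 (derive1 g1) (z 0 i1).
Let U2 := derive1 (derive1 g2) (z 0 i2).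

Lemma tangent_reflection1 : dreflection1 (g1 (z 0 i1)) (g2 (z 0 i2)) (g3 (z 0 i3))
  T1 T2 T3 U1 (v 0 i1) (v 0 i2) (v 0 i3) = 0.
Proof.
apply: (Zv (strict_deriv_bisects
  (strict_deriv2B (strict_deriv2_curve az2) (strict_deriv2_curve az1))
  (strict_deriv2B (strict_deriv2_curve az3) (strict_deriv2_curve az1))
  (strict_deriv2_curve (analytic_curve_derive az1).2))).
by move=> x /Z'Z/reflection1_eq0.
Qed.

Lemma tangent_reflection2 : dreflection2 (g1 (z 0 i1)) (g2 (z 0 i2)) (g3 (z 0 i3))
  T1 T2 T3 U2 (v 0 i1) (v 0 i2) (v 0 i3) = 0.
Proof.
apply: (Zv (strict_deriv_bisects
  (strict_deriv2B (strict_deriv2_curve az1) (strict_deriv2_curve az2))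
  (strict_deriv2B (strict_deriv2_curve az3) (strict_deriv2_curve az2))
  (strict_deriv2_curve (analytic_curve_derive az2).2))).
by move=> x /Z'Z/reflection2_eq0.
Qed.

(** The angle of the line is determined by its points [A1] and [A3]. *)
Lemma tangent_closing : v 0 i1 = 0 -> v 0 i3 = 0 -> v 0 i4 = 0.
Proof.
move=> v10 v30; have := Zv (strict_deriv_cross
  (strict_deriv2B (strict_deriv2_curve az3) (strict_deriv2_curve az1))
  (strict_deriv2_dir i4 z)) (fun x Zx => closing_eq0 (Z'Z Zx)).
rewrite v10 v30 !scale0r subr0 (side3E tri).
have -> (p q r : R * R) (k l : R) : cross 0 r + cross (k *: p) (l *: q) =
    k * (l * cross p q).
  case: p q r => [? ?] [? ?] [? ?].
  by rewrite /cross /= /GRing.scale /=; ring.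
rewrite cross_dir' mulr1 => /eqP; rewrite mulf_eq0.
by rewrite gt_eqF ?(side3_gt0 tri) //= => /eqP.
Qed.

Lemma tangent_mirror :
  (forall x, Z' x -> mirror_eqn (g1 (x 0 i1) - g2 (x 0 i2)) (derive1 g2 (x 0 i2))
    (derive1 g1 (x 0 i1)) (derive1 (derive1 g2) (x 0 i2)) = 0) ->
  v 0 i2 = 0 -> v 0 i1 * dmirror_eqn (g1 (z 0 i1) - g2 (z 0 i2)) T2 T1 U2 U1 = 0.
Proof.
move=> Z'0 v20.
have az2' := (analytic_curve_derive az2).2.
have sr := strict_deriv2B (strict_deriv2_curve az1) (strict_deriv2_curve az2).
have sU := strict_deriv2_curve (analytic_curve_derive az1).2.
have sT := strict_deriv2_curve az2'.
have sX := strict_deriv2_curve (analytic_curve_derive az2').2.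
have srT := strict_deriv_cross sr sT.
have /= := Zv (strict_derivD
  (strict_derivM (strict_derivM srT srT) (strict_deriv_dot sU sT))
  (strict_derivM (strict_derivM (strict_deriv_cross sr sU)
     (strict_deriv_cross sT sX)) (strict_deriv_dot sr sr))) Z'0.
rewrite v20; apply: etrans.
exact: dmirrorE.
Qed.
End tangent_space.

Definition triangle_lines : set (R * R) :=
  [set l | exists t1 t2 t3 v1 v2 s1 s2 c m1 m2 m3,
    [/\ [/\ analytic_curve_at g1 t1, analytic_curve_at g2 t2 &
            analytic_curve_at g3 t3],
        reflecting_triangle (g1 t1) (g2 t2) (g3 t3)
          (derive1 g1 t1) (derive1 g2 t2) (derive1 g3 t3) (dir l.1)
          v1 v2 s1 s2 c m1 m2 m3 &
        lines_through (g1 t1) l]].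

Lemma negligible_triangle_lines :
  (@line_measure R).-negligible triangle_lines.
Proof.
(* The triangles are split according to which of the curvature relations fails;
   each piece has its own parameter: [t1] on [Z2], where the relation at [A2]
   fails, and [t2] on [Z1] and [Z0]. *)
pose d1 (z : V) v1 s1 s2 c := defect1 (derive1 g1 (z 0 i1)) v1 s1 s2 c
  (derive1 (derive1 g1) (z 0 i1)).
pose d2 (z : V) v1 s1 s2 c := defect2 (derive1 g2 (z 0 i2)) v1 s1 s2 c
  (derive1 (derive1 g2) (z 0 i2)).
pose Zd (D : V -> R * R -> R -> R -> R -> Prop) : set V :=
  [set z | analytic_z z /\ exists v1 v2 s1 s2 c m1 m2 m3,
     triangle_at z v1 v2 s1 s2 c m1 m2 m3 /\ D z v1 s1 s2 c].
pose Z2 := Zd (fun z v1 s1 s2 c => d2 z v1 s1 s2 c != 0).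
pose Z1 := Zd (fun z v1 s1 s2 c => d1 z v1 s1 s2 c != 0).
pose Z0 := Zd (fun z v1 s1 s2 c => d1 z v1 s1 s2 c = 0 /\ d2 z v1 s1 s2 c = 0).
have ZdZ D : Zd D `<=` Z.
  move=> z [az [v1 [v2 [s1 [s2 [c [m1 [m2 [m3 [tri _]]]]]]]]]]; split => //.
  by exists v1, v2, s1, s2, c, m1, m2, m3.
pose lines (S : set V) := (fun z => (z 0 i4, cross (dir (z 0 i4)) (g1 (z 0 i1)))) @` S.
suff [n0 n1 n2] : [/\ (@line_measure R).-negligible (lines Z0),
    (@line_measure R).-negligible (lines Z1) &
    (@line_measure R).-negligible (lines Z2)].
  apply: negligibleS (negligibleU n0 (negligibleU n1 n2)).
  move=> l [t1 [t2 [t3 [v1 [v2 [s1 [s2 [c [m1 [m2 [m3 [az tri]]]]]]]]]]]].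
  move=> /line_point_offset ->.
  pose z : V := \row_i nth l.1 [:: t1; t2; t3] i.
  have [z1 z2 z3 z4] : [/\ z 0 i1 = t1, z 0 i2 = t2, z 0 i3 = t3 & z 0 i4 = l.1].
    by rewrite !mxE.
  have inZ (D : V -> R * R -> R -> R -> R -> Prop) : D z v1 s1 s2 c ->
      lines (Zd D) (l.1, cross (dir l.1) (g1 t1)).
    move=> Dz; exists z; last by rewrite z1 z4.
    split; first by rewrite /analytic_z z1 z2 z3.
    exists v1, v2, s1, s2, c, m1, m2, m3.
    by rewrite /triangle_at z1 z2 z3 z4.
  have [e2|e2] := eqVneq (d2 z v1 s1 s2 c) 0; last by right; right; exact: inZ.
  have [e1|e1] := eqVneq (d1 z v1 s1 s2 c) 0; last by right; left; exact: inZ.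
  by left; exact: inZ.
split; apply: negligible_lines => z
  [az [v1 [v2 [s1 [s2 [c [m1 [m2 [m3 [tri Dz]]]]]]]]]].
- exists (fun x => x 0 i2), (fun v => v 0 i2); eexists; split;
    [exact: strict_deriv_coord|by apply: strict_deriv2_curve; case: az|].
  move=> v Zv v20.
  have mirrorZ x : Z0 x -> mirror_eqn (g1 (x 0 i1) - g2 (x 0 i2))
      (derive1 g2 (x 0 i2)) (derive1 g1 (x 0 i1))
      (derive1 (derive1 g2) (x 0 i2)) = 0.
    move=> [_ [v1' [v2' [s1' [s2' [c' [m1' [m2' [m3' [tri' [_ d2x]]]]]]]]]]].
    by have := defect_mirror tri' d2x.
  have [v10 v30] := rigid_curvature tri Dz.1 Dz.2 v20
    (tangent_mirror az Zv mirrorZ v20) (tangent_reflection2 az (ZdZ _) Zv).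
  apply: row4_eq0 => //; exact: (tangent_closing az tri (ZdZ _) Zv).
- exists (fun x => x 0 i2), (fun v => v 0 i2); eexists; split;
    [exact: strict_deriv_coord|by apply: strict_deriv2_curve; case: az|].
  move=> v Zv v20; have [v10 v30] := rigid_fixing2 tri Dz v20
    (tangent_reflection1 az (ZdZ _) Zv) (tangent_reflection2 az (ZdZ _) Zv).
  apply: row4_eq0 => //; exact: (tangent_closing az tri (ZdZ _) Zv).
- exists (fun x => x 0 i1), (fun v => v 0 i1); eexists; split;
    [exact: strict_deriv_coord|by apply: strict_deriv2_curve; case: az|].
  move=> v Zv v10; have [v20 v30] := rigid_fixing1 tri Dz v10
    (tangent_reflection1 az (ZdZ _) Zv) (tangent_reflection2 az (ZdZ _) Zv).
  apply: row4_eq0 => //; exact: (tangent_closing az tri (ZdZ _) Zv).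
Qed.
End triangle_lines.

(** * Invisibility directions *)

Section main.
Variables (R : realType) (B : set (R * R)).
Let S := boundary B.

Definition regular_point (g : R -> R * R) (A : R * R) t :=
  [/\ A = g t, analytic_curve_at g t, derive1 g t != 0 &
      \forall s \near t, S (g s)].

(** At such a point the only possible tangent line of the boundary is that of the
    arc. *)
Lemma regular_reflect_dir g A t w v : regular_point g A t ->
  tangent_vector S A w -> reflect_dir w v = reflect_dir (derive1 g t) v.
Proof.
move=> [-> /analytic_curve_derive[gd _] T0 Sg] wt.
apply: reflect_dir_parallel => //; first by case: wt.
exact: tangent_vector_parallel gd Sg wt.
Qed.

(** The degenerate configurations are excluded as follows. If the first reflection
    sends the ray straight back, then [A2] comes before [A1] on the line. If
    [A3 = A1], the ray returns to [A1] along the segment on which it left, and the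
    reflection there sends it back to where it came from, with direction [- d]. *)
Lemma invisible_triangle g1 g2 g3 l (A v : nat -> R * R) t1 t2 t3 :
  regular_point g1 (A 1%N) t1 -> regular_point g2 (A 2%N) t2 ->
  regular_point g3 (A 3%N) t3 ->
  cross (dir l.1) (derive1 g1 t1) != 0 ->
  v 0%N = line_dir l -> first_point_on_line S l (A 1%N) ->
  (forall i, (1 <= i <= 3)%N ->
     exists2 t, tangent_vector S (A i) t & v i = reflect_dir t (v i.-1)) ->
  (forall i, (1 <= i < 3)%N -> first_point_on_ray S (A i) (v i) (A i.+1)) ->
  v 3%N = line_dir l -> (exists s, A 3%N = line_point l s) ->
  triangle_lines g1 g2 g3 l.
Proof.
move=> r1 r2 r3 nT v0 [q1 [A1l SA1 first1]] refl ray v3 [q3 A3l].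
exists t1, t2, t3.
have [w1 w1t v1E] := refl 1%N isT.
have [w2 w2t v2E] := refl 2%N isT.
have [w3 w3t v3E] := refl 3%N isT.
have [s1 s10 [A2E SA2 _]] := ray 1%N isT.
have [s2 s20 [A3E SA3 _]] := ray 2%N isT.
move: v1E v2E v3E; rewrite /= v0 v3 -[line_dir l]/(dir l.1); set d := dir l.1 => v1E v2E v3E.
rewrite (regular_reflect_dir _ r1 w1t) in v1E.
rewrite (regular_reflect_dir _ r2 w2t) in v2E.
rewrite (regular_reflect_dir _ r3 w3t) in v3E.
case: (r1) => A1E az1 T10 _; case: (r2) => A2E' az2 T20 _.
case: (r3) => A3E' az3 T30 _.
set T1 := derive1 g1 t1 in nT v1E T10.
set T2 := derive1 g2 t2 in v2E T20.
set T3 := derive1 g3 t3 in v3E T30.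
have u0 : dot d d = 1 by exact: dir_unit.
have u1 : dot (v 1%N) (v 1%N) = 1 by rewrite v1E (dot_reflect_dir _ T10) u0.
have u2 : dot (v 2%N) (v 2%N) = 1 by rewrite v2E (dot_reflect_dir _ T20) u1.
have e1 : A 2%N - A 1%N = s1 *: v 1%N by rewrite A2E addrC addKr.
have e2 : A 3%N - A 2%N = s2 *: v 2%N by rewrite A3E addrC addKr.
have ahead q : line_point l q - line_point l q1 = (q - q1) *: d.
  by rewrite /line_point opprD addrACA subrr add0r scalerBl.
have e3 : A 3%N - A 1%N = (q3 - q1) *: d by rewrite A3l A1l ahead.
have loop : (q3 - q1) *: d = s1 *: v 1%N + s2 *: v 2%N.
  by rewrite -e1 -e2 -e3 [RHS]addrC subrKA.
(* The first segment does not lie on the line. *)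
have nd : cross (v 1%N) d != 0.
  rewrite v1E cross_reflect_dir; apply/negP.
  have -> : cross T1 d = - cross d T1 by rewrite /cross; ring.
  rewrite mulf_eq0 oppr_eq0 (negPf nT) orbF => /eqP e0.
  have v1d : v 1%N = - d by rewrite v1E /reflect_dir e0 scale0r add0r.
  apply: (first1 (q1 - s1)); first by rewrite gtrBl.
  suff <- : A 2%N = line_point l (q1 - s1) by [].
  rewrite A2E v1d scalerN A1l /line_point -addrA; congr (_ + _).
  by rewrite scalerBl.
(* [A3] comes strictly after [A1] on the line. *)
have c0 : 0 < q3 - q1.
  rewrite subr_gt0 lt_neqAle; apply/andP; split; last first.
    by rewrite leNgt; apply/negP => /first1; apply; rewrite -A3l.
  apply/eqP => q13.
  have A31 : A 3%N = A 1%N by rewrite A3l A1l q13.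
  have v2v1 : v 2%N = - ((s1 / s2) *: v 1%N).
    have : s2 *: v 2%N = - (s1 *: v 1%N).
      move: loop; rewrite q13 subrr scale0r => /esym/eqP.
      by rewrite addrC addr_eq0 => /eqP.
    move=> /(congr1 (fun w => s2^-1 *: w)); rewrite scalerA mulVf ?gt_eqF //.
    by rewrite scale1r scalerN scalerA mulrC.
  have k1 : s1 / s2 = 1.
    have : (s1 / s2) ^+ 2 = 1.
      rewrite -u2 v2v1 -[LHS]mulr1 -u1; case: (v 1%N) => ? ?.
      by rewrite /dot /= /GRing.scale /=; ring.
    move/eqP; rewrite sqrf_eq1 => /orP[/eqP //|/eqP e].
    by have := divr_gt0 s10 s20; rewrite e oppr_gt0 ltr10.
  rewrite k1 scale1r in v2v1.
  have r31 : regular_point g1 (A 3%N) t1 by rewrite A31.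
  have : d = - d.
    have := regular_reflect_dir (v 2%N) r31 w3t.
    rewrite (regular_reflect_dir _ r3 w3t) -v3E v2v1 reflect_dirN v1E.
    by rewrite (reflect_dirK _ T10) => dN; exact: dN.
  move=> dN; have : dot d d = - dot d d.
    by rewrite {1}dN /dot /= !mulNr -opprD.
  by rewrite u0 => /eqP; rewrite -subr_eq0 opprK -mulr2n pnatr_eq0.
have nd12 : cross (v 1%N) (v 2%N) != 0.
  apply: contra_neq nd => e.
  have cz (a b : R * R) k : cross a (k *: b) = k * cross a b.
    by case: a b => [? ?] [? ?]; rewrite /cross /= /GRing.scale /=; ring.
  apply: (mulfI (lt0r_neq0 c0)); rewrite mulr0 -cz loop.
  have -> : cross (v 1%N) (s1 *: v 1%N + s2 *: v 2%N) = s2 * cross (v 1%N) (v 2%N).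
    case: (v 1%N) (v 2%N) => [? ?] [? ?].
    by rewrite /cross /= /GRing.scale /=; ring.
  by rewrite e mulr0.
have nd23 : cross (v 2%N) d != 0.
  apply: contra_neq nd => e.
  apply: (mulfI (lt0r_neq0 s10)); rewrite mulr0.
  have : cross ((q3 - q1) *: d) d = 0 by rewrite crossZl crossvv mulr0.
  by rewrite loop crossDl !crossZl e mulr0 addr0.
have nd01 : cross d (v 1%N) != 0.
  have -> : cross d (v 1%N) = - cross (v 1%N) d by rewrite /cross; ring.
  by rewrite oppr_eq0.
have [m1 m10 T1E] := mirror_bisector T10 v1E nd01.
have [m2 m20 T2E] := mirror_bisector T20 v2E nd12.
have [m3 m30 T3E] := mirror_bisector T30 v3E nd23.
exists (v 1%N), (v 2%N), s1, s2, (q3 - q1), m1, m2, m3; split; first by split.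
  rewrite -A1E -A2E' -A3E'; rewrite addrC in T1E.
  exact: (ReflectingTriangle u1 u2 u0 s10 s20 c0 e1 e2 e3 T1E T2E T3E m10 m20 m30 nd).
by exists q1; rewrite -A1E.
Qed.

Lemma arc_points (a b : R) (g : R -> R * R) A : (g @` `[a, b]) A ->
  [\/ A = g a, A = g b | exists2 t, t \in `]a, b[ & A = g t].
Proof.
move=> [t /= tab <-]; move: tab; rewrite in_itv /= => /andP[].
rewrite le_eqVlt => /orP[/eqP ->|at_]; first by constructor 1.
rewrite le_eqVlt => /orP[/eqP ->|tb]; first by constructor 2.
by constructor 3; exists t => //; rewrite in_itv /= at_.
Qed.
End main.

Theorem corollary1p19 (R : realType) (B : set (R * R)) :
  body B -> piecewise_analytic (boundary B) -> ~ k_reflective 3 B.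
Proof.
move=> _ [n [E [arcE BE]]]; apply; set S := boundary B in BE *.
have /choice[arc arcP] : forall i, exists abg : R * R * (R -> R * R),
    (forall t, t \in `]abg.1.1, abg.1.2[ ->
       analytic_curve_at abg.2 t /\ derive1 abg.2 t != 0) /\
    E i = abg.2 @` `[abg.1.1, abg.1.2].
  move=> i; have [a [b [g [_ _ _ gP ->]]]] := arcE i.
  by exists (a, b, g); split => // t /gP[].
pose g i := (arc i).2.
(* The two end points of the [i]-th arc. *)
pose e i (c : bool) := g i (if c then (arc i).1.1 else (arc i).1.2).
have pointP A : S A -> (exists i c, A = e i c) \/ exists i t, regular_point B (g i) A t.
  rewrite BE => -[i _]; have [gP ->] := arcP i.
  move=> /arc_points[->|->|[t tab ->]].
  - by left; exists i, true.
  - by left; exists i, false.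
  - right; exists i, t; have [gt gt0] := gP t tab; split => //.
    rewrite -/(boundary B) -/S BE; near=> s; exists i => //; have [_ ->] := arcP i.
    exists s => //=; apply: subset_itv_oo_cc; near: s.
    exact: near_in_itvoo.
have n0 : (@line_measure R).-negligible (\bigcup_ic lines_through (e ic.1 ic.2)).
  by apply: negligible_bigcup_countable => ic; exact: negligible_lines_through.
have n1 : (@line_measure R).-negligible (\bigcup_i tangent_lines (g i)).
  by apply: negligible_bigcup_countable => i; exact: negligible_tangent_lines.
have n2 : (@line_measure R).-negligible
    (\bigcup_ijc lines_reflected_to (g ijc.1) (e ijc.2.1 ijc.2.2)).
  apply: negligible_bigcup_countable => ijc.
  exact: negligible_lines_reflected_to.
have n3 : (@line_measure R).-negligible
    (\bigcup_ijk triangle_lines (g ijk.1) (g ijk.2.1) (g ijk.2.2)).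
  by apply: negligible_bigcup_countable => ijk; exact: negligible_triangle_lines.
apply: negligibleS (negligibleU n0 (negligibleU n1 (negligibleU n2 n3))).
move=> l [_ [_ [A [v [[v0 A1f] refl ray [v3 A3l] _]]]]].
have [q1 [A1l SA1 _]] := A1f.
have [s1 s10 [A2E SA2 _]] := ray 1%N isT.
have [_ _ [_ SA3 _]] := ray 2%N isT.
have [[i [c A1e]]|[i [t1 r1]]] := pointP _ SA1.
  by left; exists (i, c) => //=; exists q1; rewrite -A1e.
have [[k [c A3e]]|[k [t3 r3]]] := pointP _ SA3.
  by left; exists (k, c) => //=; rewrite -A3e.
have [A1E az1 T10 _] := r1.
have A1l' : lines_through (g i t1) l by exists q1; rewrite -A1E.
have [dT1|dT1] := eqVneq (cross (dir l.1) (derive1 (g i) t1)) 0.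
  by right; left; exists i => //; exists t1; split.
have [[j [c A2e]]|[j [t2 r2]]] := pointP _ SA2.
  right; right; left; exists (i, (j, c)) => //=; exists t1.
  have A21 : A 2%N - A 1%N = s1 *: v 1%N by rewrite A2E addrC addKr.
  have [w wt v1E] := refl 1%N isT.
  rewrite (regular_reflect_dir _ r1 wt) /= v0 in v1E.
  split => //; rewrite -A2e -A1E.
    rewrite -subr_eq0 A21 scaler_eq0 negb_or gt_eqF //=.
    apply/eqP => v10; have /eqP := dir_unit l.1.
    rewrite -(dot_reflect_dir _ T10) -[dir _]/(line_dir l) -v1E v10 /dot /= !mulr0 addr0.
    by rewrite eq_sym oner_eq0.
  by rewrite A21 v1E; exact: bisects_reflect_dir.
right; right; right; exists (i, (j, k)) => //.
exact: (invisible_triangle r1 r2 r3 dT1 v0 A1f refl ray v3 A3l).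
Unshelve. all: by end_near. Qed.
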